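(* (1) Let $\mathcal{F}=(m_{i,j})$ be a finite frieze pattern of Type $\Lambda_{p_1,\ldots,p_s}$ of width $n-3$ which is realizable by a dissected $n$-gon $P$ with vertices $v_1,\ldots,v_n$. Then for all $i,j$ with $0\le j-i\le n$, $m_{i,j}=\sum_{w\in\mathcal{M}_{i,j}}wt_L(w)$, where $\mathcal{M}_{i,j}$ is the set of matchings between $v_i$ and $v_j$ in $P$. (2) Let $\mathcal{F}=(m_{i,j})$ be an infinite $n$-periodic frieze pattern of Type $\Lambda_{p_1,\ldots,p_s}$ which is realizable by a dissection of $S_n$ or $A_{n,m}$ or by a quotient dissection of $A_{n,m}$, and let $I$ be the dissected infinite strip which is its universal cover, with lower marked points $u_i$, $i\in\mathbb{Z}$, $u_i$ lying over $v_{i\bmod n}$. Then for all $j\ge i$, $m_{i,j}=\sum_{w\in\mathcal{M}_{i,j}}wt_L(w)$, where $\mathcal{M}_{i,j}$ is the set of matchings between $u_i$ and $u_j$ in $I$.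
   Context: Frieze pattern: array $(m_{i,j})_{j\ge i}$ of reals with $m_{i,i}=0$, $m_{i,i+1}=1$, $m_{i-1,j}m_{i,j+1}-m_{i,j}m_{i+1,j+1}=1$; finite of width $w$ if additionally $m_{i,i+w+3}=0$ for all $i$ (rows beyond are not considered); quiddity row $m_{i-1,i+1}$; $n$-periodic if the quiddity row is. $\lambda_p=2\cos(\pi/p)$; Type $\Lambda_{p_1,\ldots,p_s}$: quiddity entries are sums of positive integer multiples of $\lambda_{p_1},\ldots,\lambda_{p_s}$. $U_k$ are the normalized Chebyshev polynomials: $U_{-1}=0$, $U_0=1$, $U_k(x)=xU_{k-1}(x)-U_{k-2}(x)$. Dissections: a dissection of a polygon, of $A_{n,m}$ (annulus with $n$ outer, $m$ inner marked points) or of $S_n$ (disc with $n$ boundary marked points and a puncture) is a set of non-crossing arcs between marked points dividing the surface into polygons (subgons), $|\mathcal{P}|$ = number of sides; for $A_{n,m}$ no arc joins two inner points. Outer/boundary vertices $v_1,\ldots,v_n$ counterclockwise, indices mod $n$. A frieze pattern is realizable by the dissection if $m_{i-1,i+1}=\sum\lambda_{|\mathcal{P}|}$ over subgons $\mathcal{P}$ incident to $v_i$ (counted by corners at $v_i$). A quotient dissection of $A_{n,m}$ is obtained from a dissection by iteratively identifying pairs of equal-size subgons sharing an outer vertex, never identifying two subgons that share an edge nor subgons with all vertices on the outer boundary; its incidence at $v_i$ counts identified subgons once, and realizability is defined likewise. Universal cover: for $A_{n,m}$, cut along a bridging arc (joining $v_1$ to an inner point) and glue $\mathbb{Z}$ copies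 of the resulting dissected polygon along this arc, giving a periodically dissected infinite strip with lower marked points $u_i$ ($i\in\mathbb{Z}$, in order) lying over $v_{i\bmod n}$ and upper marked points over inner vertices. For $S_n$, the strip has lower marked points $u_i$ and a point $+\infty$; each arc from $v_a$ to the puncture lifts to arcs from every $u_i$ with $i\equiv a$ to $+\infty$, and the regions between them are dissected as the corresponding regions of $S_n$. The covering map preserves subgon sizes and the subgons incident to $u_i$ correspond to the corners at $v_{i\bmod n}$. For a quotient dissection, lifts of two identified subgons that are incident to a common lift of their shared outer vertex are identified in the strip. Matchings: in a dissected $n$-gon (indices mod $n$) or in the strip (vertices $u_k$), a matching between the $i$-th and $j$-th vertex ($j\ge i$) is a sequence $w=(\mathcal{P}_{i+1},\ldots,\mathcal{P}_{j-1})$ where $\mathcal{P}_k$ is a subgon incident to the $k$-th vertex; $\mathcal{M}_{i,i+1}=\{\emptyset\}$, $\mathcal{M}_{i,i}=\emptyset$. Local weight: $wt_L(\emptyset)=1$; if the first $k\ge1$ entries of $w$ equal $\mathcal{P}_{i+1}$ and the $(k+1)$-st does not (or $w$ has length $k$), then $wt_L(w)=U_k(\lambda_{|\mathcal{P}_{i+1}|})\,wt_L(\mathcal{P}_{i+k+1},\ldots,\mathcal{P}_{j-1})$, where equality of subgons is equality in the polygon or strip (with identifications in the quotient case).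
   Formalization: The unimodular rule is taken as m_{i-1,j}m_{i,j+1} − m_{i,j}m_{i-1,j+1} = 1 (the printed one is a misprint), and for quotient dissections the frieze is assumed tame (adjacent 3×3 minors vanish), since otherwise zero entries leave it undetermined and the claim fails. *)

(* Defs.v *)
From HB Require Import structures.
From mathcomp Require Import all_boot all_order all_algebra.
From mathcomp Require Import all_classical all_reals all_analysis.
From Stdlib Require Import Relation_Operators.

Set Implicit Arguments.
Unset Strict Implicit.
Unset Printing Implicit Defensive.

Import Order.TTheory GRing.Theory Num.Theory.

Local Open Scope classical_set_scope.
Local Open Scope ring_scope.

Section Friezes.
Variable R : realType.
Implicit Type F : int -> int -> R.

Definition lambda (p : nat) : R := 2 * cos (pi / p%:R).

(* Only the entries F i j with i <= j are ever constrained.  The four entries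
   of the unimodular rule form a diamond with left and right corners F (i-1) j
   and F i (j+1), top F i j and bottom F (i-1) (j+1). *)
Definition frieze F : Prop :=
  [/\ forall i, F i i = 0,
      forall i, F i (i + 1) = 1
    & forall i j, i <= j ->
        F (i - 1) j * F i (j + 1) - F i j * F (i - 1) (j + 1) = 1].

(* The rows j - i > w + 3 are left unconstrained. *)
Definition finite_frieze (w : nat) F : Prop :=
  [/\ forall i, F i i = 0,
      forall i, F i (i + 1) = 1,
      forall i j, i <= j -> (j + 1) - (i - 1) <= (w + 3)%:Z ->
        F (i - 1) j * F i (j + 1) - F i j * F (i - 1) (j + 1) = 1
    & forall i, F i (i + (w + 3)%:Z) = 0].

Definition quiddity F (i : int) : R := F (i - 1) (i + 1).

Definition n_periodic (n : nat) F : Prop :=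
  forall i, quiddity F (i + n%:Z) = quiddity F i.

(* A multiplicity may vanish for some of the p's, but not for all of them. *)
Definition type_Lambda (ps : seq nat) F : Prop :=
  all (leq 3) ps /\
  forall i, exists c : 'I_(size ps) -> nat,
    (exists k, (0 < c k)%N) /\
    quiddity F i = \sum_(k < size ps) (c k)%:R * lambda (nth 0%N ps k).

(* A frieze in the above sense need not be determined by its quiddity row once
   some entry F i j with i < j vanishes; a tame one always is. *)
Definition tame F : Prop :=
  forall i j, i + 2 <= j ->
    \det (\matrix_(r < 3, c < 3) F (i + r%:Z) (j + c%:Z)) = 0.

Fixpoint chebU (k : nat) (x : R) : R :=
  match k with
  | 0 => 1
  | k'.+1 => x * chebU k' x - (if k' is k''.+1 then chebU k'' x else 0)
  end.

End Friezes.

(* What a dissected polygon or strip contributes to matchings: the (possibly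
   identified) subgons, those incident to the k-th vertex for k : int, and their
   numbers of sides. *)
Record tiling := Tiling {
  tile :> choiceType;
  incident : int -> set tile;
  sides : tile -> nat
}.
Arguments incident : clear implicits.

Section Matchings.
Variables (R : realType) (T : tiling).

Definition realizable (F : int -> int -> R) : Prop :=
  forall i, quiddity F i = \sum_(P \in incident T i) lambda R (sides P).

(* Entry number k of w is the subgon chosen at vertex i + 1 + k; for j = i the
   length condition is unsatisfiable, for j = i + 1 it forces w = [::]. *)
Definition matchings (i j : int) : set (seq T) :=
  [set w | (size w)%:Z = j - i - 1 /\
           forall (P0 : T) (k : nat), (k < size w)%N ->
             incident T (i + 1 + k%:Z) (nth P0 w k)].

(* wtL_run P k w is the weight of k copies of P followed by w. *)
Fixpoint wtL_run (P : T) (k : nat) (w : seq T) : R :=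
  match w with
  | [::] => chebU k (lambda R (sides P))
  | Q :: w' => if Q == P then wtL_run P k.+1 w'
               else chebU k (lambda R (sides P)) * wtL_run Q 1 w'
  end.

Definition wtL (w : seq T) : R :=
  if w is P :: w' then wtL_run P 1 w' else 1.

Definition matching_sum (i j : int) : R := \sum_(w \in matchings i j) wtL w.

End Matchings.

(* V is the set of marked points of a disc, lt their order along the boundary
   circle cut open at one place.  An arc or side is a pair (x, y) with lt x y. *)
Section Dissections.
Variables (V : eqType) (lt side : rel V).

Record dissection := Dissection {
  arc : rel V;
  arc_lt : forall x y, arc x y -> lt x y;
  arc_not_side : forall x y, arc x y -> ~~ side x y;
  arc_noncrossing : forall x y z t, arc x y -> arc z t ->
    ~~ [&& lt x z, lt z y & lt y t]
}.

Definition edge (D : dissection) : rel V := fun x y => side x y || arc D x y.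

(* A subgon is the list of its vertices in boundary order: cyclically
   consecutive vertices, and no others, are joined by a side or an arc. *)
Definition subgon (D : dissection) (P : seq V) : Prop :=
  [/\ (2 < size P)%N, sorted lt P
    & forall x0 i j, (i < j < size P)%N ->
        edge D (nth x0 P i) (nth x0 P j) =
          (j == i.+1) || ((i == 0%N) && (j == (size P).-1))].

End Dissections.

Section Polygon.
Variable n : nat.

Definition polygon_lt : rel 'I_n := fun x y => (x < y)%N.

Definition polygon_side : rel 'I_n := fun x y =>
  (y == x.+1 :> nat) || ((x == 0 :> nat) && (y == n.-1 :> nat)).

Definition polygon_dissection := dissection polygon_lt polygon_side.

Definition polygon_tiling (D : polygon_dissection) : tiling :=
  @Tiling (seq 'I_n)
    (fun k => [set P | subgon D P /\
                       exists2 x : 'I_n, x \in P & (x%:Z = k %[mod n%:Z])%Z])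
    size.

End Polygon.

(* The universal cover of A_{n,m} is a strip with lower marked points inl i over
   the outer vertices and upper ones inr k over the inner vertices, both numbered
   from left to right.  Its boundary is read along the lower line from left to
   right, then along the upper line from right to left. *)
Definition ann_lt : rel (int + int) := fun x y =>
  match x, y with
  | inl i, inl j => i < j
  | inl _, inr _ => true
  | inr _, inl _ => false
  | inr k, inr l => l < k
  end.

Definition ann_side : rel (int + int) := fun x y =>
  match x, y with
  | inl i, inl j => j == i + 1
  | inr k, inr l => k == l + 1
  | _, _ => false
  end.

Definition ann_deck (n m : nat) (t : int) (x : int + int) : int + int :=
  match x with
  | inl i => inl (i + t * n%:Z)
  | inr k => inr (k + t * m%:Z)
  end.

(* An isotopy class of arcs in A_{n,m} is an orbit of strip arcs under deck
   transformations, so a set of arcs in A_{n,m} is a deck-invariant set of strip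
   arcs.  The regions are polygons iff some arc joins the two boundaries. *)
Record annulus_dissection (n m : nat) := AnnulusDissection {
  ann_strip :> dissection ann_lt ann_side;
  ann_periodic : forall t x y,
    arc ann_strip (ann_deck n m t x) (ann_deck n m t y) = arc ann_strip x y;
  ann_no_inner : forall k l, ~~ arc ann_strip (inr k) (inr l);
  ann_bridging : exists i k, arc ann_strip (inl i) (inr k)
}.

(* The corners at v_i are in bijection with the subgons of the strip incident to
   inl i, so this tiling also expresses realizability by the annulus itself. *)
Definition annulus_cover (n m : nat) (D : annulus_dissection n m) : tiling :=
  @Tiling (seq (int + int))
    (fun k => [set P | subgon D P /\ inl k \in P])
    size.

(* For S_n the upper boundary of the strip is the single point inr tt, which is
   +oo. *)
Definition punct_lt : rel (int + unit) := fun x y =>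
  match x, y with
  | inl i, inl j => i < j
  | inl _, inr _ => true
  | inr _, _ => false
  end.

Definition punct_side : rel (int + unit) := fun x y =>
  match x, y with
  | inl i, inl j => j == i + 1
  | _, _ => false
  end.

Definition punct_deck (n : nat) (t : int) (x : int + unit) : int + unit :=
  match x with
  | inl i => inl (i + t * n%:Z)
  | inr _ => inr tt
  end.

Record punctured_dissection (n : nat) := PuncturedDissection {
  punct_strip :> dissection punct_lt punct_side;
  punct_periodic : forall t x y,
    arc punct_strip (punct_deck n t x) (punct_deck n t y) = arc punct_strip x y;
  punct_bridging : exists i, arc punct_strip (inl i) (inr tt)
}.

Definition punctured_cover (n : nat) (D : punctured_dissection n) : tiling :=
  @Tiling (seq (int + unit))
    (fun k => [set P | subgon D P /\ inl k \in P])
    size.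

Section Quotient.
Variables (n m : nat) (D : annulus_dissection n m).
Implicit Types (P Q X Y : seq (int + int)) (E : seq (int + int) -> seq (int + int) -> Prop).

(* Subgons of the annulus are orbits of subgons of the strip. *)
Definition same_orbit P Q : Prop := exists t, Q = map (ann_deck n m t) P.

Definition share_outer_vertex P Q : Prop := exists k, inl k \in P /\ inl k \in Q.

Definition share_edge P Q : Prop :=
  exists x y, [/\ edge D x y, x \in P, y \in P, x \in Q & y \in Q].

Definition has_inner_vertex P : Prop := exists k, inr k \in P.

(* E relates the strip subgons lying over identified subgons of the annulus.  An
   identification is tested in the quotient reached so far: two classes share an
   edge as soon as some of their members do. *)
Definition identifiable E P Q : Prop :=
  [/\ subgon D P /\ subgon D Q, size P = size Q, share_outer_vertex P Q,
      has_inner_vertex P /\ has_inner_vertex Q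
    & forall P' Q', E P P' -> E Q Q' -> ~ share_edge P' Q'].

Definition identify E P Q X Y : Prop :=
  [\/ E X Y, E X P /\ E Q Y | E X Q /\ E P Y].

Inductive quotient_dissection :
    (seq (int + int) -> seq (int + int) -> Prop) -> Prop :=
| quotient_none : quotient_dissection same_orbit
| quotient_step E P Q : quotient_dissection E -> identifiable E P Q ->
    quotient_dissection (identify E P Q).

(* Lifts of one and the same subgon of the annulus are not identified by this
   rule, but may end up identified through lifts of others. *)
Definition strip_identified E X Y : Prop :=
  [/\ subgon D X /\ subgon D Y, E X Y, ~ same_orbit X Y
    & share_outer_vertex X Y].

Definition strip_class E P : set (seq (int + int)) :=
  [set Q | clos_refl_sym_trans _ (strip_identified E) P Q].

(* All members of a class have the same size. *)
Definition quotient_cover E : tiling :=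
  @Tiling (set (seq (int + int)))
    (fun k => [set strip_class E P | P in [set P | subgon D P /\ inl k \in P]])
    (fun C => size (xget [::] C)).

End Quotient.

(* Main.v *)
Require Import Defs.
From Stdlib Require Import Relation_Operators.
From mathcomp Require Import all_boot all_order all_algebra zify ring lra.
From mathcomp Require Import all_classical all_reals all_analysis.

(* By the Chebyshev recursion, appending one more subgon to a matching shows that
   the matching sums S(i,j) satisfy S(i,j+1) = q_j S(i,j) - c_j S(i,j-1), where q is
   the quiddity row and c_j is the number of subgons incident to both the (j-1)-st
   and the j-th vertex.  Always c_j = 1: the boundary edge lies in a single subgon,
   and in a quotient a chain of identified subgons from one side of this edge to the
   other passes through that subgon.  A tame frieze obeys the same recursion.

   A frieze that is not assumed tame is determined by its quiddity row as soon as
   the matching sums do not vanish.  For a dissected polygon they are positive: a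
   function given at the two ends of one side extends over each subgon like
   k |-> a sin((p-1-k) pi/p) + b sin(k pi/p), and the extension solves the recursion,
   since around a vertex the contributions of the subgons telescope.  Two such
   solutions have a positive Wronskian, which is the matching sum.  A strip reduces
   to polygons by cutting it along two distant bridging arcs. *)

Set Implicit Arguments.
Unset Strict Implicit.
Unset Printing Implicit Defensive.
Import Order.TTheory GRing.Theory Num.Theory.

(** * Subgons and separation *)

(* Opaque boolean hypotheses make [lia] explode. *)
Ltac nlia :=
  repeat match goal with
  | H : is_true (?f _ _) |- _ => is_var f; clear H
  | H : is_true (_ \in _) |- _ => clear H
  | H : is_true (_ \notin _) |- _ => clear H
  | H : is_true (sorted _ _) |- _ => clear H
  | H : is_true (has _ _) |- _ => clear H
  | H : is_true (~~ has _ _) |- _ => clear H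
  | H : forall _, _ |- _ => clear H
  | H : _ = nth _ _ _ |- _ => clear H
  | H : nth _ _ _ = _ |- _ => clear H
  | H : _ \/ _ |- _ => clear H
  end; try change (Equality.sort Datatypes_nat__canonical__eqtype_Equality) with nat in *; lia.

Section Gon.
Variables (V : eqType) (lt e : rel V).

(** This is [subgon] for an arbitrary edge relation, so that what follows applies both to
    dissections and to graphs on [nat]. *)
Definition gon (P : seq V) : Prop :=
  [/\ (2 < size P)%N, sorted lt P
    & forall x0 i j, (i < j < size P)%N ->
        e (nth x0 P i) (nth x0 P j) =
          (j == i.+1) || ((i == 0%N) && (j == (size P).-1))].

Definition strict_total : Prop :=
  [/\ irreflexive lt, transitive lt & forall x y, x != y -> lt x y || lt y x].

Definition noncrossing : Prop :=
  forall x y z t, e x y -> e z t -> ~~ [&& lt x z, lt z y & lt y t].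

Hypothesis lt_order : strict_total.
Hypothesis e_nc : noncrossing.

Lemma strict_asym x y : lt x y -> lt y x -> False.
Proof. case: lt_order => irr tr _ xy yx; by have := tr _ _ _ xy yx; rewrite irr. Qed.

Lemma sorted_nth_lt x0 (P : seq V) i j : sorted lt P -> (i < size P)%N ->
  (j < size P)%N -> lt (nth x0 P i) (nth x0 P j) = (i < j)%N.
Proof.
case: lt_order => irr tr _ sP hi hj.
have H := sorted_ltn_nth tr x0 sP.
case: (ltngtP i j) => [ij|ji|->]; last by rewrite irr.
  by rewrite H.
by apply/negP => /strict_asym; apply; exact: H.
Qed.

(** The gap around z ends at the first vertex of P beyond z. *)
Lemma sorted_gap x0 (P : seq V) z i j : sorted lt P -> z \notin P ->
  (i < size P)%N -> (j < size P)%N ->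
  lt (nth x0 P i) z -> lt z (nth x0 P j) ->
  exists k, [/\ (i <= k < j)%N, lt (nth x0 P k) z & lt z (nth x0 P k.+1)].
Proof.
case: lt_order => irr tr tot sP zP hi hj iz zj.
have hz : has (lt z) P by apply/hasP; exists (nth x0 P j) => //; apply: mem_nth.
have zf : lt z (nth x0 P (find (lt z) P)) by apply: nth_find.
have hf : (find (lt z) P < size P)%N by rewrite -has_find.
have lif : (i < find (lt z) P)%N.
  by rewrite -(sorted_nth_lt x0 sP) //; apply: tr zf.
have fj : (find (lt z) P <= j)%N.
  rewrite leqNgt; apply/negP => jf.
  by have := before_find x0 jf; rewrite zj.
exists (find (lt z) P).-1.
have pf : ((find (lt z) P).-1 < find (lt z) P)%N by nlia.
split; [nlia| |by rewrite prednK //; nlia].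
have hps : ((find (lt z) P).-1 < size P)%N by nlia.
have /tot : nth x0 P (find (lt z) P).-1 != z.
  by apply: contraNneq zP => <-; apply: mem_nth.
by rewrite (before_find x0 pf) orbF.
Qed.

(** No edge separates two vertices of a subgon. Walking around P from p to q in either direction,
    one must pass through x and through y, as otherwise an edge of P crosses (x, y). Two vertices of
    P joined by an edge are cyclically consecutive, which leaves no room for p on one side and q on
    the other. *)
Lemma gon_separated P x y p q : gon P -> e x y -> p \in P -> q \in P ->
  lt x p -> lt p y -> lt q x || lt y q -> False.
Proof.
move=> [sz sP ed] exy pP qP xp py qout.
have [irr tr tot] := lt_order.
have [x0 _] : exists x0 : V, True by exists x.
have ip : (index p P < size P)%N by rewrite index_mem.
have iq : (index q P < size P)%N by rewrite index_mem.
have np : nth x0 P (index p P) = p by apply: nth_index.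
have nq : nth x0 P (index q P) = q by apply: nth_index.
set ip' := index p P in ip np; set iq' := index q P in iq nq.
have edc k : (k.+1 < size P)%N -> e (nth x0 P k) (nth x0 P k.+1).
  by move=> hk; rewrite ed ?eqxx // ltnSn.
have edl : e (nth x0 P 0) (nth x0 P (size P).-1).
  by rewrite ed ?eqxx ?orbT //; nlia.
have le0 r : r \in P -> nth x0 P 0 = r \/ lt (nth x0 P 0) r.
  move=> rP; case: (posnP (index r P)) => [h|h].
    by left; rewrite -(nth_index x0 rP) h.
  right; rewrite -(nth_index x0 rP) sorted_nth_lt ?index_mem //; nlia.
have lel r : r \in P -> r = nth x0 P (size P).-1 \/ lt r (nth x0 P (size P).-1).
  move=> /(nthP x0)[k hk <-].
  case: (eqVneq k (size P).-1) => [<-|hn]; first by left.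
  by right; rewrite sorted_nth_lt //; nlia.
(* If y is not a vertex of P, then (x, y) is crossed by the edge of P that jumps over y or, when no
   vertex lies beyond y, by the edge from the first to the last vertex. *)
have yIn : (exists2 r, r \in P & lt y r) \/ lt q x -> y \in P.
  move=> H; apply/negPn/negP => yP.
  case: (boolP (has (lt y) P)) => [/hasP[r rP yr]|nr].
    have ir : (index r P < size P)%N by rewrite index_mem.
    have [||k [kk ky yk]] := @sorted_gap x0 P y ip' (index r P) sP yP ip ir.
    - by rewrite np.
    - by rewrite nth_index.
    have xk : lt x (nth x0 P k).
      case: (eqVneq k ip') => [->|kn]; first by rewrite np.
      apply: tr xp _; rewrite -np sorted_nth_lt //; nlia.
    have := e_nc exy (edc k _); rewrite xk ky yk => /(_ _)/negP; apply=> //; nlia.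
  case: H => [[r rP yr]|qx]; first by case/negP: nr; apply/hasP; exists r.
  have lP : nth x0 P (size P).-1 \in P by apply: mem_nth; nlia.
  have ly : lt (nth x0 P (size P).-1) y.
    have /tot/orP[//|h] : nth x0 P (size P).-1 != y by apply: contraNneq yP => <-.
    by case/negP: nr; apply/hasP; exists (nth x0 P (size P).-1).
  have xl : lt x (nth x0 P (size P).-1) by case: (lel _ pP) => [<-//|]; apply: tr.
  have fx : lt (nth x0 P 0) x by case: (le0 _ qP) => [->//|h]; apply: tr qx.
  by have := e_nc edl exy; rewrite fx xl ly.
have xIn : (exists2 r, r \in P & lt r x) \/ lt y q -> x \in P.
  move=> H; apply/negPn/negP => xP.
  case: (boolP (has (lt^~ x) P)) => [/hasP[r rP yr]|nr].
    have ir : (index r P < size P)%N by rewrite index_mem.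
    have [||k [kk kx xk]] := @sorted_gap x0 P x (index r P) ip' sP xP ir ip.
    - by rewrite nth_index.
    - by rewrite np.
    have ky : lt (nth x0 P k.+1) y.
      case: (eqVneq k.+1 ip') => [->|kn]; first by rewrite np.
      apply: tr py; rewrite -np sorted_nth_lt //; nlia.
    have := e_nc (edc k _) exy; rewrite kx xk ky => /(_ _)/negP; apply=> //; nlia.
  case: H => [[r rP yr]|yq]; first by case/negP: nr; apply/hasP; exists r.
  have fP : nth x0 P 0 \in P by apply: mem_nth; nlia.
  have xf : lt x (nth x0 P 0).
    have /tot/orP[h|//] : nth x0 P 0 != x by apply: contraNneq xP => <-.
    by case/negP: nr; apply/hasP; exists (nth x0 P 0).
  have fy : lt (nth x0 P 0) y by case: (le0 _ pP) => [->//|h]; apply: tr py.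
  have yl : lt y (nth x0 P (size P).-1) by case: (lel _ qP) => [<-//|]; apply: tr.
  by have := e_nc exy edl; rewrite xf fy yl.
have [xP yP] : x \in P /\ y \in P.
  by case/orP: qout => h; split; [apply: xIn|apply: yIn|apply: xIn|apply: yIn];
    [left; exists q|right|right|left; exists q].
case/(nthP x0): xP => ix hix ex; case/(nthP x0): yP => iy hiy ey.
move: exy xp py qout; clear yIn xIn le0 lel edl edc.
rewrite -np -nq -ex -ey !sorted_nth_lt // => E h1 h2 h3.
by move: E; rewrite ed; nlia.
Qed.

(** Adjacent positions amount to having no vertex in between. With the converse [gonI], this
    replaces positions by vertices in the arguments below. *)
Lemma gon_edgeE x0 P a b : gon P -> a \in P -> b \in P -> lt a b ->
  e a b = ~~ has (fun c => lt a c && lt c b) P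
          || ((a == head x0 P) && (b == last x0 P)).
Proof.
move=> [sz sP ed] /(nthP x0)[i ia <-] /(nthP x0)[j ib <-].
have [irr tr tot] := lt_order.
have un : uniq P by apply: (sorted_uniq tr).
rewrite sorted_nth_lt // => ab; rewrite ed ?ab // -nth0 -nth_last !nth_uniq //; try nlia.
congr (_ || _); case: eqP => h; symmetry.
  apply/hasPn => c /(nthP x0)[k hk <-]; rewrite h !sorted_nth_lt //; nlia.
apply/negbTE; rewrite negbK; apply/hasP.
exists (nth x0 P i.+1); first by apply: mem_nth; nlia.
by rewrite !sorted_nth_lt //; nlia.
Qed.

Lemma gonI x0 P : (2 < size P)%N -> sorted lt P ->
  (forall a b, a \in P -> b \in P -> lt a b ->
    e a b = ~~ has (fun c => lt a c && lt c b) P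
          || ((a == head x0 P) && (b == last x0 P))) -> gon P.
Proof.
move=> sz sP H; split=> // y0 i j hij.
have [irr tr tot] := lt_order.
have un : uniq P by apply: (sorted_uniq tr).
have hi : (i < size P)%N by nlia.
have hj : (j < size P)%N by nlia.
rewrite !(set_nth_default x0 y0) // H ?mem_nth // ?sorted_nth_lt //; last by nlia.
rewrite -nth0 -nth_last !nth_uniq //; try nlia.
congr (_ || _); case: eqP => h; last first.
  apply/negbTE; rewrite negbK; apply/hasP.
  exists (nth x0 P i.+1); first by apply: mem_nth; nlia.
  by rewrite !sorted_nth_lt //; nlia.
apply/hasPn => c /(nthP x0)[k hk <-]; rewrite h !sorted_nth_lt //; nlia.
Qed.

End Gon.

(** * Subgons of a polygon *)

Lemma ltn_strict_total : strict_total ltn.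
Proof. by split=> [x|y x z|x y] /=; lia. Qed.

Lemma sorted_nth_ltn (P : seq nat) i j : sorted ltn P -> i < size P ->
  j < size P -> (nth 0 P i < nth 0 P j) = (i < j).
Proof. exact: (sorted_nth_lt ltn_strict_total). Qed.

Lemma sorted_head_le (P : seq nat) v : sorted ltn P -> v \in P -> head 0 P <= v.
Proof.
case: P => //= a P; rewrite path_sortedE; last exact: ltn_trans.
by case/andP => /allP H _; rewrite inE => /orP[/eqP->//|/H /= /ltnW].
Qed.

Lemma sorted_le_last (P : seq nat) v : sorted ltn P -> v \in P -> v <= last 0 P.
Proof.
case/lastP: P => // P a; rewrite last_rcons -[rcons P a]revK rev_rcons rev_sorted.
rewrite mem_rev /= path_sortedE; last by move=> x y z /=; lia.
by case/andP => /allP H _; rewrite inE => /orP[/eqP->//|/H /= /ltnW].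
Qed.

Section PolygonGraph.
Variables (N : nat) (e : rel nat).

(* The sides and arcs of an N-gon with vertices 0, ..., N-1. *)
Definition polygon_graph : Prop :=
  [/\ 2 < N, forall x y, e x y -> x < y < N, forall x, x.+1 < N -> e x x.+1,
      e 0 N.-1 & noncrossing ltn e].

Hypothesis pg : polygon_graph.

Lemma N_gt2 : 2 < N. Proof. by case: pg. Qed.
Lemma e_lt x y : e x y -> x < y < N. Proof. by case: pg => _ + _ _ _; apply. Qed.
Lemma e_succ x : x.+1 < N -> e x x.+1. Proof. by case: pg => _ _ + _ _; apply. Qed.
Lemma e_out : e 0 N.-1. Proof. by case: pg. Qed.
Lemma e_nc : noncrossing ltn e. Proof. by case: pg. Qed.

Lemma e_cross x y z t : e x y -> e z t -> x < z -> z < y -> y < t -> False.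
Proof. by move=> h1 h2 h3 h4 h5; have := e_nc h1 h2; rewrite /= h3 h4 h5. Qed.

(** The search is bounded so that the result is a boolean, which can then filter a list of
    vertices. *)
Definition covered x y v :=
  has (fun u => has (fun w => [&& e u w, (u, w) != (x, y), u < v & v < w])
    (iota x (y - x).+1)) (iota x (y - x).+1).

Lemma coveredP x y v : x <= y ->
  reflect (exists u w, [/\ e u w, (u, w) <> (x, y), x <= u < v & v < w <= y])
          (covered x y v).
Proof.
move=> xy; apply: (iffP hasP) => [[u]|[u [w [h1 h2 h3 h4]]]].
  rewrite mem_iota => hu /hasP[w]; rewrite mem_iota => hw /and4P[h1 /eqP h2 h3 h4].
  by exists u, w; split=> //; nlia.
exists u; first by rewrite mem_iota; nlia.
apply/hasP; exists w; first by rewrite mem_iota; nlia.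
by apply/and4P; split=> //; [apply/eqP|nlia|nlia].
Qed.

(* The subgon below the edge (x, y) consists of the vertices from x to y that are
   not cut off by another edge. *)
Definition below x y := [seq v <- iota x (y - x).+1 | ~~ covered x y v].

Lemma mem_below x y v : x <= y ->
  (v \in below x y) = (x <= v <= y) && ~~ covered x y v.
Proof. by move=> xy; rewrite mem_filter mem_iota andbC; congr (_ && _); nlia. Qed.

Lemma below_sorted x y : sorted ltn (below x y).
Proof. by apply: sorted_filter (iota_ltn_sorted _ _); exact: ltn_trans. Qed.

Lemma below_left x y : x <= y -> x \in below x y.
Proof.
by move=> xy; rewrite mem_below // leqnn xy; apply/coveredP => // -[u [w []]]; nlia.
Qed.

Lemma below_right x y : x <= y -> y \in below x y.
Proof.
by move=> xy; rewrite mem_below // leqnn xy; apply/coveredP => // -[u [w []]]; nlia.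
Qed.

Lemma head_below x y : x <= y -> head 0 (below x y) = x.
Proof.
move=> xy; have xb := below_left xy.
have hb : head 0 (below x y) \in below x y.
  by case: (below x y) xb => // a s _; rewrite inE eqxx.
have := sorted_head_le (below_sorted x y) xb.
by move: hb; rewrite mem_below //; nlia.
Qed.

Lemma last_below x y : x <= y -> last 0 (below x y) = y.
Proof.
move=> xy; have yb := below_right xy.
have hb : last 0 (below x y) \in below x y.
  by case: (below x y) yb => // a s _; apply: mem_last.
have := sorted_le_last (below_sorted x y) yb.
by move: hb; rewrite mem_below //; nlia.
Qed.

Lemma max_edge a (Q : pred nat) w0 : e a w0 -> Q w0 ->
  exists w, [/\ e a w, Q w & forall w', e a w' -> Q w' -> w' <= w].
Proof.
move=> ew0 Qw0.
have ex : exists w, e a w && Q w by exists w0; rewrite ew0.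
have bd w : e a w && Q w -> w <= N by move=> /andP[/e_lt]; nlia.
case: (ex_maxnP ex bd) => w /andP[h1 h2] h3.
by exists w; split=> // w' h4 h5; apply: h3; rewrite h4.
Qed.

(** Every vertex between a and b is covered, and the covering edge stays between a and b because
    these two are not covered themselves. In particular an edge starts at a, the only vertex before
    [a.+1] in that range. *)
Lemma below_edge x y a b : e x y -> a \in below x y -> b \in below x y ->
  a < b -> ~~ has (fun c => a < c < b) (below x y) -> e a b.
Proof.
move=> exy; have xy : x <= y by have := e_lt exy; nlia.
rewrite !mem_below // => /andP[ha ca] /andP[hb cb] ab nob.
have [baE|ban] := eqVneq b a.+1.
  by rewrite baE; apply: e_succ; have := e_lt exy; nlia.
have cov c : a < c < b -> exists u w, [/\ e u w, (u, w) <> (x, y), a <= u < c & c < w <= b].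
  move=> hc; have /negPn/(coveredP _ xy)[u [w [h1 h2 h3 h4]]] : ~~ ~~ covered x y c.
    apply/negP => nc; case/hasP: nob; exists c => //.
    by rewrite mem_below // nc; nlia.
  exists u, w; split=> //.
    suff : a <= u by nlia.
    rewrite leqNgt; apply/negP => ua; case/(coveredP _ xy): ca.
    by exists u, w; split=> //; nlia.
  suff : w <= b by nlia.
  rewrite leqNgt; apply/negP => ua; case/(coveredP _ xy): cb.
  by exists u, w; split=> //; nlia.
have [u [w [h1 h2 h3 h4]]] := cov a.+1 ltac:(nlia).
have ua : u = a by nlia.
rewrite {u}ua in h1 h2 h3.
(* The longest such edge from a ends at b: an edge over its end w' would either cross it or start at
   a and be longer. *)
have [|w' [e1 /andP[q1 q2] e3]] :=
    @max_edge a (fun w => (w <= b) && ((a, w) != (x, y))) w h1.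
  by apply/andP; split; [nlia|apply/eqP].
suff -> : b = w' by [].
apply/eqP/negPn/negP => bw'.
have aw := e_lt e1.
have [u [t [g1 g2 g3 g4]]] := cov w' ltac:(nlia).
have [uE|un] := eqVneq u a; last by apply: (e_cross e1 g1); nlia.
rewrite {u}uE in g1 g2 g3.
have := e3 t g1; rewrite (_ : t <= b) => [/(_ _)|]; last by nlia.
by have /eqP-> := g2; nlia.
Qed.

(** A third vertex is the end of the longest edge from x that stops before y. An edge between two
    non-consecutive vertices, other than (x, y) itself, would cover the vertices between them. *)
Lemma gon_below x y : e x y -> x.+1 < y -> gon ltn e (below x y).
Proof.
move=> exy xy1; have xy : x <= y by nlia.
have yN := e_lt exy.
apply: (gonI (x0 := 0) ltn_strict_total _ (below_sorted x y)).
  have [||w [e1 /andP[q1 q2] e3]] := @max_edge x (fun w => x < w < y) x.+1.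
  - by apply: e_succ; nlia.
  - by nlia.
  have wb : w \in below x y.
    rewrite mem_below //; apply/andP; split; first by nlia.
    apply/(coveredP _ xy) => -[u [t [g1 g2 g3 g4]]].
    have [uE|un] := eqVneq u x; last by apply: (e_cross e1 g1); nlia.
    rewrite {u}uE in g1 g2 g3.
    have [tE|tn] := eqVneq t y; first by rewrite tE in g2.
    have := e3 t g1; nlia.
  suff : size [:: x; w; y] <= size (below x y) by [].
  apply: uniq_leq_size => [|z].
    by rewrite /= !inE; nlia.
  by rewrite !inE => /or3P[]/eqP->; [exact: below_left| |exact: below_right].
move=> a b aB bB /= ab; rewrite head_below // last_below //.
case: (boolP (has _ _)) => [/hasP[c cB /= acb]|] /=; last first.
  by move=> h; rewrite (below_edge exy).
apply/idP/idP => [eab|/andP[/eqP-> /eqP->]//].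
move: aB bB cB; rewrite !mem_below // => /andP[ha _] /andP[hb _] /andP[hc].
apply: contraR => nab; apply/(coveredP _ xy).
exists a, b; split=> //; [|nlia|nlia].
by move=> [aE bE]; move: nab; rewrite aE bE !eqxx.
Qed.

Section GonFacts.
Variable P : seq nat.
Hypothesis gP : gon ltn e P.

Lemma gon_head_mem : head 0 P \in P.
Proof. by case: gP; case: P => // a s _ _ _; rewrite inE eqxx. Qed.

Lemma gon_last_mem : last 0 P \in P.
Proof. by case: gP; case: P => // a s _ _ _; apply: mem_last. Qed.

Lemma gon_le v : v \in P -> head 0 P <= v <= last 0 P.
Proof. by case: gP => _ sP _ vP; rewrite sorted_head_le // sorted_le_last. Qed.

Lemma gon_edge a b : a \in P -> b \in P -> a < b ->
  e a b = ~~ has (fun c => a < c < b) P || ((a == head 0 P) && (b == last 0 P)).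
Proof. exact: gon_edgeE ltn_strict_total _ _ _ _ gP. Qed.

Lemma gon_middle : exists2 c, c \in P & head 0 P < c < last 0 P.
Proof.
case: gP => sz sP _; exists (nth 0 P 1); first by apply: mem_nth; nlia.
rewrite -nth0 -nth_last.
by rewrite !sorted_nth_ltn //; nlia.
Qed.

Lemma gon_base : e (head 0 P) (last 0 P).
Proof.
rewrite gon_edge ?gon_head_mem ?gon_last_mem ?eqxx ?orbT //.
by have [c _] := gon_middle; nlia.
Qed.

(** A subgon is determined by its base. An edge covering a vertex of P would separate it from an end
    of the base; conversely, a point in the range of P that is not a vertex lies in a gap of P, and
    the edge spanning this gap covers it. *)
Lemma gon_below_base : P = below (head 0 P) (last 0 P).
Proof.
have [sz sP _] := gP; have [c cP hc] := gon_middle; have eb := gon_base.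
have xy : head 0 P <= last 0 P by nlia.
apply: (@irr_sorted_eq _ ltn) => //; [exact: ltn_trans|exact: ltnn|exact: below_sorted|].
move=> v; rewrite mem_below //; apply/idP/idP => [vP|/andP[hv]].
  rewrite gon_le //=; apply/(coveredP _ xy) => -[u [w [h1 h2 h3 h4]]].
  have [uE|un] := eqVneq u (head 0 P).
    have wl : w != last 0 P by apply/eqP => wE; apply: h2; rewrite uE wE.
    apply: (gon_separated ltn_strict_total e_nc gP h1 vP gon_last_mem) => /=; nlia.
  apply: (gon_separated ltn_strict_total e_nc gP h1 vP gon_head_mem) => /=; nlia.
apply: contraR => vP; apply/(coveredP _ xy).
have [||k [hk h1 h2]] :=
  @sorted_gap _ _ ltn_strict_total 0 P v 0 (size P).-1 sP vP ltac:(nlia) ltac:(nlia).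
- rewrite nth0 /=; have : v != head 0 P by apply: contraNneq vP => ->; exact: gon_head_mem.
  by nlia.
- rewrite nth_last /=; have : v != last 0 P by apply: contraNneq vP => ->; exact: gon_last_mem.
  by nlia.
have kP : nth 0 P k \in P by apply: mem_nth; nlia.
have kP' : nth 0 P k.+1 \in P by apply: mem_nth; nlia.
have := gon_le kP; have := gon_le kP'; move: h1 h2 => /= h1 h2 h3 h4.
exists (nth 0 P k), (nth 0 P k.+1); split; [|move=> [kh kl]|nlia|nlia].
  by case: gP => _ _ ->; rewrite ?eqxx //; nlia.
(* The gap is not the base, since the middle vertex c would lie strictly inside it. *)
have := sorted_nth_ltn (i := k) sP (j := index c P).
have := sorted_nth_ltn (i := index c P) sP (j := k.+1).
rewrite index_mem cP nth_index //= kh kl; nlia.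
Qed.

End GonFacts.

Lemma gon_eq_base P Q : gon ltn e P -> gon ltn e Q ->
  head 0 P = head 0 Q -> last 0 P = last 0 Q -> P = Q.
Proof.
by move=> gP gQ h l; rewrite (gon_below_base gP) (gon_below_base gQ) h l.
Qed.

(** Since a subgon is recovered from its base, running through the edges enumerates all subgons. *)
Definition gons := undup [seq below x y |
  x <- iota 0 N, y <- [seq y <- iota 0 N | e x y && (x.+1 < y)]].

Lemma gonsP P : reflect (gon ltn e P) (P \in gons).
Proof.
rewrite mem_undup; apply: (iffP allpairsPdep) => [[x [y [_]]]|gP].
  by rewrite mem_filter => /andP[/andP[exy xy] _] ->; apply: gon_below.
exists (head 0 P), (last 0 P); have eb := gon_base gP; have := e_lt eb.
have [c _ hc] := gon_middle gP => hN.
rewrite mem_filter !mem_iota eb; split; [nlia|nlia|exact: gon_below_base].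
Qed.

Definition gons_at v := [seq P <- gons | v \in P].

Lemma gons_atP v P : reflect (gon ltn e P /\ v \in P) (P \in gons_at v).
Proof. by rewrite mem_filter andbC; apply: (iffP andP) => -[/gonsP]. Qed.

Lemma gons_at_uniq v : uniq (gons_at v).
Proof. by rewrite filter_uniq // undup_uniq. Qed.

(** * The subgons on the two sides of an edge *)

Lemma min_edge (Q : nat -> nat -> bool) x0 y0 : e x0 y0 -> Q x0 y0 ->
  exists x y, [/\ e x y, Q x y &
    forall u w, e u w -> Q u w -> y - x <= w - u].
Proof.
move=> e0 q0.
pose len d := has (fun x => e x (x + d) && Q x (x + d)) (iota 0 N).
have exd : exists d, len d.
  exists (y0 - x0); apply/hasP; have := e_lt e0 => h.
  by exists x0; rewrite ?mem_iota ?subnKC ?e0 //; nlia.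
case: (ex_minnP exd) => d /hasP[x _ /andP[h1 h2]] h3.
exists x, (x + d); split=> // u w h4 h5.
have uw := e_lt h4; rewrite addKn; apply: h3; apply/hasP.
by exists u; rewrite ?mem_iota ?subnKC ?h4 //; nlia.
Qed.

(** The subgon on the outer side of (v, w) has as base the shortest edge that properly encloses (v,
    w). An edge covering v or w would have to enclose (v, w), as the two cannot cross, and would be
    shorter than this base. *)
Lemma gon_above v w : e v w -> (v, w) <> (0, N.-1) ->
  exists2 P, gon ltn e P &
    [/\ v \in P, w \in P, ~~ has (fun c => v < c < w) P
      & (v, w) <> (head 0 P, last 0 P)].
Proof.
move=> evw vw0; have hvw := e_lt evw.
have [|x [y [exy /and3P[q1 q2 q3] mn]]] :=
    @min_edge (fun x y => [&& x <= v, w <= y & (x, y) != (v, w)]) _ _ e_out.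
  by apply/and3P; split=> //; [nlia|apply/eqP => h; apply: vw0; rewrite h].
have hxy := e_lt exy; have xy : x <= y by nlia.
have ne : (x != v) || (y != w).
  by rewrite -negb_and; apply: contra q3 => /andP[/eqP-> /eqP->].
have gP : gon ltn e (below x y) by apply: gon_below => //; nlia.
have mem z : (z == v) || (z == w) -> z \in below x y.
  move=> hz; rewrite mem_below //; apply/andP; split; first by nlia.
  apply/(coveredP _ xy) => -[u [t [h1 h2 h3 h4]]].
  have hu : u <= v.
    rewrite leqNgt; apply/negP => vu; apply: (e_cross evw h1); nlia.
  have ht : w <= t.
    rewrite leqNgt; apply/negP => vu; apply: (e_cross h1 evw); nlia.
  have := mn u t h1; rewrite hu ht /=.
  have -> : (u, t) != (v, w) by apply/eqP => -[]; nlia.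
  move=> /(_ isT) hle; apply: h2; congr (_, _); nlia.
have vP : v \in below x y by apply: mem; rewrite eqxx.
have wP : w \in below x y by apply: mem; rewrite eqxx orbT.
exists (below x y) => //; rewrite head_below // last_below //.
have nb : (v, w) <> (x, y) by move=> [h1 h2]; move: q3; rewrite h1 h2 eqxx.
split=> //.
move: evw; rewrite (gon_edge gP) //; last by nlia.
rewrite head_below // last_below // => /orP[//|/andP[/eqP h1 /eqP h2]].
by case: nb; rewrite h1 h2.
Qed.

(** One of v, w lies strictly inside the base of Q, which cannot separate the vertices of P; hence P
    lies within that base. By symmetry the two bases agree. *)
Lemma gon_above_uniq v w P Q : v < w -> gon ltn e P -> gon ltn e Q ->
  v \in P -> w \in P -> v \in Q -> w \in Q ->
  (v, w) <> (head 0 P, last 0 P) -> (v, w) <> (head 0 Q, last 0 Q) -> P = Q.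
Proof.
move=> vw gP gQ vP wP vQ wQ nP nQ.
have key A B : gon ltn e A -> gon ltn e B -> v \in A -> w \in A ->
    v \in B -> w \in B -> (v, w) <> (head 0 B, last 0 B) ->
    head 0 B <= head 0 A /\ last 0 A <= last 0 B.
  move=> gA gB vA wA vB wB nB.
  have [a [aA hA1 hA2]] : exists a, [/\ a \in A, head 0 B < a & a < last 0 B].
    have := gon_le gB vB; have := gon_le gB wB => h1 h2.
    have [h|h] : head 0 B < v \/ w < last 0 B.
    - case: (ltnP (head 0 B) v) => h; first by left.
      case: (ltnP w (last 0 B)) => h'; first by right.
      by case: nB; congr (_, _); nlia.
    - by exists v; split=> //; nlia.
    - by exists w; split=> //; nlia.
  have sep := gon_separated ltn_strict_total e_nc gA (gon_base gB) aA.
  split; rewrite leqNgt; apply/negP => h.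
    by apply: (sep _ (gon_head_mem gA)) => //=; rewrite h.
  by apply: (sep _ (gon_last_mem gA)) => //=; rewrite h orbT.
have := key P Q gP gQ vP wP vQ wQ nQ; have := key Q P gQ gP vQ wQ vP wP nP.
by move=> h1 h2; apply: gon_eq_base => //; nlia.
Qed.

Lemma gon_side x : x.+1 < N -> exists P, forall Q,
  (gon ltn e Q /\ x \in Q /\ x.+1 \in Q) <-> Q = P.
Proof.
move=> hx; have hN := N_gt2; have ne : (x, x.+1) <> (0, N.-1) by move=> [h1 h2]; nlia.
have [P gP [xP yP no nb]] := gon_above (e_succ hx) ne.
exists P => Q; split=> [[gQ [xQ yQ]]|->//].
apply: (@gon_above_uniq x x.+1) => // -[h1 h2].
have [c cQ] := gon_middle gQ; nlia.
Qed.

Lemma gon_bottom : exists P, forall Q,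
  (gon ltn e Q /\ 0 \in Q /\ N.-1 \in Q) <-> Q = P.
Proof.
have hN := N_gt2; have gP : gon ltn e (below 0 N.-1).
  by apply: gon_below e_out _; nlia.
exists (below 0 N.-1) => Q; split=> [[gQ [xQ yQ]]|->]; last first.
  by split=> //; rewrite below_left // below_right.
have := e_lt (gon_base gQ); have := gon_le gQ xQ; have := gon_le gQ yQ => h1 h2 h3.
by apply: gon_eq_base => //; rewrite ?head_below ?last_below; nlia.
Qed.

(** The edges passing strictly over v are nested, since they do not cross, so the shortest one is
    the innermost. By [gon_apexP], it is the base of the subgon that has v as a middle vertex. *)
Lemma gon_apex v : 0 < v < N.-1 -> exists x y,
  [/\ e x y, x < v < y & forall u w, e u w -> u < v < w -> u <= x /\ y <= w].
Proof.
move=> hv.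
have [x [y [exy q mn]]] := @min_edge (fun x y => x < v < y) _ _ e_out hv.
exists x, y; split=> // u w euw huw.
have h := mn u w euw huw.
split; rewrite leqNgt; apply/negP => h'.
  apply: (e_cross exy euw); nlia.
apply: (e_cross euw exy); nlia.
Qed.

Lemma gon_apexP P v u w : gon ltn e P -> v \in P -> head 0 P < v < last 0 P ->
  e u w -> u < v < w -> u <= head 0 P /\ last 0 P <= w.
Proof.
move=> gP vP hv euw huw.
have sep := gon_separated ltn_strict_total e_nc gP euw vP.
split; rewrite leqNgt; apply/negP => h.
  apply: (sep _ (gon_head_mem gP)) => /=; nlia.
apply: (sep _ (gon_last_mem gP)) => /=; nlia.
Qed.

(** Neighbours are cyclic: past the last vertex the default value [head 0 P] is returned, and in
    [gon_pred] the prepended [last 0 P] precedes the first vertex. *)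
Definition gon_succ (P : seq nat) v := nth (head 0 P) P (index v P).+1.
Definition gon_pred (P : seq nat) v := nth 0 (last 0 P :: P) (index v P).

Definition cyc_succ v := if v == N.-1 then 0 else v.+1.
Definition cyc_pred v := if v == 0 then N.-1 else v.-1.

Lemma gon_uniq P : gon ltn e P -> uniq P.
Proof. by move=> [_ sP _]; apply: sorted_uniq sP; [exact: ltn_trans|exact: ltnn]. Qed.

Lemma gon_succ_nth P k : gon ltn e P -> k < size P ->
  gon_succ P (nth 0 P k) = if k.+1 == size P then head 0 P else nth 0 P k.+1.
Proof.
move=> gP hk; rewrite /gon_succ index_uniq ?gon_uniq //; case: eqP => h.
  by rewrite nth_default // h.
by apply: set_nth_default; nlia.
Qed.

Lemma gon_pred_nth P k : gon ltn e P -> k < size P ->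
  gon_pred P (nth 0 P k) = if k == 0 then last 0 P else nth 0 P k.-1.
Proof.
by move=> gP hk; rewrite /gon_pred index_uniq ?gon_uniq //; case: k hk.
Qed.

Lemma gon_succK P v : gon ltn e P -> v \in P -> gon_pred P (gon_succ P v) = v.
Proof.
move=> gP /(nthP 0)[k hk <-]; rewrite gon_succ_nth //; case: eqP => h.
  rewrite -nth0 gon_pred_nth //=; last by nlia.
  by rewrite -nth_last -h.
by rewrite gon_pred_nth //; nlia.
Qed.

Lemma gon_succ_mem P v : gon ltn e P -> v \in P -> gon_succ P v \in P.
Proof.
move=> gP /(nthP 0)[k hk <-]; rewrite gon_succ_nth //; case: eqP => h.
  exact: gon_head_mem gP.
by apply: mem_nth; nlia.
Qed.

Lemma gon_predK P v : gon ltn e P -> v \in P -> gon_succ P (gon_pred P v) = v.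
Proof.
move=> gP /(nthP 0)[k hk <-]; rewrite gon_pred_nth //; case: eqP => h.
  rewrite -nth_last gon_succ_nth //; last by nlia.
  by rewrite prednK ?eqxx ?h ?nth0 //; nlia.
rewrite gon_succ_nth //; last by nlia.
by rewrite prednK; [case: eqP => // |]; nlia.
Qed.

Lemma gon_pred_mem P v : gon ltn e P -> v \in P -> gon_pred P v \in P.
Proof.
move=> gP /(nthP 0)[k hk <-]; rewrite gon_pred_nth //; case: eqP => h.
  exact: gon_last_mem gP.
by apply: mem_nth; nlia.
Qed.

Lemma gon_succ_cases P v : gon ltn e P -> v \in P ->
  [/\ v < gon_succ P v, e v (gon_succ P v) & ~~ has (fun c => v < c < gon_succ P v) P]
  \/ v = last 0 P /\ gon_succ P v = head 0 P.
Proof.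
move=> gP /(nthP 0)[k hk <-]; rewrite gon_succ_nth //; case: eqP => h.
  by right; split=> //; rewrite -nth_last -h.
left; have [sz sP ed] := gP; have hk1 : k.+1 < size P by nlia.
split; first by rewrite sorted_nth_ltn.
  by rewrite ed ?eqxx // hk1 ltnSn.
apply/hasPn => c /(nthP 0)[i hi <-].
by rewrite !sorted_nth_ltn //; nlia.
Qed.

Lemma gon_succ_last P : gon ltn e P -> gon_succ P (last 0 P) = head 0 P.
Proof.
move=> gP; have [sz _ _] := gP.
rewrite -nth_last gon_succ_nth //; last by nlia.
by rewrite prednK ?eqxx //; nlia.
Qed.

Lemma gon_succ_between P v w : gon ltn e P -> v \in P -> w \in P -> v < w ->
  ~~ has (fun c => v < c < w) P -> gon_succ P v = w.
Proof.
move=> gP vP wP vw no.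
have [[h1 h2 h3]|[h1 h2]] := gon_succ_cases gP vP.
  case: (ltngtP (gon_succ P v) w) => // h.
    by case/negP: no; apply/hasP; exists (gon_succ P v); rewrite ?gon_succ_mem //; nlia.
  by case/negP: h3; apply/hasP; exists w => //; nlia.
by have := gon_le gP wP; rewrite -h1; nlia.
Qed.

Lemma gon_succ_neighbor P v : gon ltn e P -> v \in P ->
  (e v (gon_succ P v) || e (gon_succ P v) v) && (gon_succ P v != cyc_pred v).
Proof.
move=> gP vP; have hN := N_gt2; have [c cP hc] := gon_middle gP.
have bd z : z \in P -> z < N.
  by move=> zP; have := e_lt (gon_base gP); have := gon_le gP zP; nlia.
rewrite /cyc_pred; have [[h1 h2 h3]|[h1 h2]] := gon_succ_cases gP vP.
  rewrite h2 /=; case: (eqVneq v 0) => h; last by nlia.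
  apply/eqP => h'; case/negP: h3; apply/hasP; exists c => //.
  have := bd _ (gon_last_mem gP); have := gon_le gP vP; nlia.
rewrite h2 {1 2}h1 gon_base // orbT /=; case: (eqVneq v 0) => h; nlia.
Qed.

(** Read from v to w, an edge has one subgon on a fixed side: the one above it if v < w, the one
    below it if w < v. Only the step from v to its boundary predecessor has nothing on that side. *)
Lemma gon_succ_exists v w : v < N -> w < N -> (e v w || e w v) -> w != cyc_pred v ->
  exists P, [/\ gon ltn e P, v \in P & gon_succ P v = w].
Proof.
move=> hv hw + nw; case/orP => [evw|ewv].
  have ne : (v, w) <> (0, N.-1).
    by move=> [h1 h2]; move: nw; rewrite /cyc_pred h1 h2 /= eqxx.
  have [P gP [vP wP no nb]] := gon_above evw ne.
  by exists P; split=> //; apply: gon_succ_between => //; have := e_lt evw; nlia.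
have hwv := e_lt ewv.
have h : w.+1 < v by move: nw; rewrite /cyc_pred; case: (eqVneq v 0) => ?; nlia.
have wv : w <= v by nlia.
exists (below w v).
have gP : gon ltn e (below w v) by exact: gon_below.
split=> //; first exact: below_right.
by have := gon_succ_last gP; rewrite last_below // head_below.
Qed.

Lemma gon_succ_inj P Q v : gon ltn e P -> gon ltn e Q -> v \in P -> v \in Q ->
  gon_succ P v = gon_succ Q v -> P = Q.
Proof.
move=> gP gQ vP vQ E.
have aux A : gon ltn e A -> v \in A -> v < gon_succ A v ->
    (v, gon_succ A v) <> (head 0 A, last 0 A).
  move=> gA vA vs [h1 h2]; have [[_ _]|[h3 h4]] := gon_succ_cases gA vA; last first.
    by have := gon_le gA vA; nlia.
  case/negP; have [c cA hc] := gon_middle gA.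
  by apply/hasP; exists c => //; rewrite h2 h1.
case: (ltnP v (gon_succ P v)) => h.
  apply: (@gon_above_uniq v (gon_succ P v) P Q) => //.
  - exact: gon_succ_mem.
  - by rewrite E; exact: gon_succ_mem.
  - exact: aux.
  - by rewrite E; apply: aux; rewrite -?E.
have [[h1 _ _]|[h1 h2]] := gon_succ_cases gP vP; first by nlia.
have [[h3 _ _]|[h3 h4]] := gon_succ_cases gQ vQ; first by nlia.
by apply: (gon_eq_base gP gQ); nlia.
Qed.

Definition neighbors v := [seq w <- iota 0 N | e v w || e w v].

Lemma neighbors_succ v : v < N ->
  perm_eq [seq gon_succ P v | P <- gons_at v]
          [seq w <- neighbors v | w != cyc_pred v].
Proof.
move=> hv; have hN := N_gt2; have gaP := gons_atP.
apply: uniq_perm.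
- rewrite map_inj_in_uniq ?gons_at_uniq // => P Q /gaP[gP vP] /gaP[gQ vQ].
  exact: gon_succ_inj.
- by rewrite !filter_uniq // iota_uniq.
move=> w; rewrite !mem_filter mem_iota /= add0n; apply/idP/idP.
  case/mapP => P /gaP[gP vP] ->.
  have /andP[h1 h2] := gon_succ_neighbor gP vP; rewrite h1 h2 /=.
  by have := e_lt (gon_base gP); have := gon_le gP (gon_succ_mem gP vP); nlia.
case/and3P => h1 h2 h3; have [P [gP vP <-]] := gon_succ_exists hv h3 h2 h1.
by apply/mapP; exists P => //; apply/gaP.
Qed.

Lemma neighbors_pred v : v < N ->
  perm_eq [seq gon_pred P v | P <- gons_at v]
          [seq w <- neighbors v | w != cyc_succ v].
Proof.
move=> hv; have hN := N_gt2; have gaP := gons_atP.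
have cyc w : w < N -> (w != cyc_succ v) = (v != cyc_pred w).
  by move=> hw; rewrite /cyc_succ /cyc_pred; case: (eqVneq v N.-1); case: (eqVneq w 0); nlia.
apply: uniq_perm.
- rewrite map_inj_in_uniq ?gons_at_uniq // => P Q /gaP[gP vP] /gaP[gQ vQ] E.
  apply: (@gon_succ_inj P Q (gon_pred P v)) => //.
  + exact: gon_pred_mem.
  + by rewrite E; exact: gon_pred_mem.
  + by rewrite gon_predK // E gon_predK.
- by rewrite !filter_uniq // iota_uniq.
move=> w; rewrite !mem_filter mem_iota /= add0n; apply/idP/idP.
  case/mapP => P /gaP[gP vP] ->; have pP := gon_pred_mem gP vP.
  have /andP := gon_succ_neighbor gP pP; rewrite gon_predK // => -[h1 h2].
  have hp : gon_pred P v < N.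
    by have := e_lt (gon_base gP); have := gon_le gP pP; nlia.
  by rewrite cyc // h2 orbC h1.
case/and3P => h1 h2 h3; rewrite cyc // in h1; rewrite orbC in h2.
have [P [gP wP E]] := gon_succ_exists h3 hv h2 h1.
have vP : v \in P by rewrite -E gon_succ_mem.
apply/mapP; exists P; first by apply/gaP.
by rewrite -E gon_succK.
Qed.

Local Open Scope ring_scope.

(* Every neighbour of v is the successor of v in one subgon and its predecessor
   in another one, except for the two neighbours of v on the boundary. *)
Lemma telescope_around (M : zmodType) (h : nat -> M) v : (v < N)%N ->
  \sum_(P <- gons_at v) (h (gon_succ P v) - h (gon_pred P v))
  = h (cyc_succ v) - h (cyc_pred v).
Proof.
move=> hv; have hN := N_gt2; rewrite sumrB.
have -> : \sum_(P <- gons_at v) h (gon_succ P v)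
          = \sum_(w <- neighbors v | w != cyc_pred v) h w.
  rewrite -[RHS]big_filter -(perm_big _ (neighbors_succ hv)) /=.
  by rewrite big_map.
have -> : \sum_(P <- gons_at v) h (gon_pred P v)
          = \sum_(w <- neighbors v | w != cyc_succ v) h w.
  rewrite -[RHS]big_filter -(perm_big _ (neighbors_pred hv)) /=.
  by rewrite big_map.
have un : uniq (neighbors v) by rewrite filter_uniq // iota_uniq.
have hp : cyc_pred v \in neighbors v.
  rewrite mem_filter mem_iota /cyc_pred /= add0n; case: (eqVneq v 0) => [v0|v0].
    by rewrite v0 e_out /=; nlia.
  have := e_succ (x := v.-1); rewrite prednK; last by nlia.
  by move=> -> //; rewrite orbT /=; nlia.
have hs : cyc_succ v \in neighbors v.
  rewrite mem_filter mem_iota /cyc_succ /= add0n; case: (eqVneq v N.-1) => [vN|vN].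
    by rewrite vN e_out orbT /=; nlia.
  by rewrite e_succ /=; nlia.
have E1 : \sum_(w <- neighbors v) h w = _ := bigD1_seq _ hp un.
have E2 : \sum_(w <- neighbors v) h w = _ := bigD1_seq _ hs un.
move: E1; rewrite E2 => E1.
by apply/eqP; rewrite subr_eq addrAC E1 addrC addKr.
Qed.

End PolygonGraph.

Local Open Scope classical_set_scope.
Local Open Scope ring_scope.

(** * Positivity of lengths in a polygon *)

Section SineRatio.
Variables (R : realType) (p : nat).
Hypothesis p_gt2 : (2 < p)%N.

(** The length of a diagonal spanning k sides of the regular p-gon with side 1. *)
Definition sine_ratio (k : nat) : R :=
  sin (k%:R * (pi / p%:R)) / sin (pi / p%:R).

Lemma sine_ratio_gt0 k : (0 < k < p)%N -> 0 < sine_ratio k.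
Proof.
have p0 : 0 < p%:R :> R by rewrite ltr0n; lia.
have sin_pos j : (0 < j < p)%N -> 0 < sin (j%:R * (pi / p%:R) : R).
  move=> /andP[j0 jp]; apply: sin_gt0_pi; apply/andP; split.
    by apply: mulr_gt0; [rewrite ltr0n|apply: divr_gt0; [exact: pi_gt0|]].
  by rewrite mulrA ltr_pdivrMr // mulrC ltr_pM2l ?pi_gt0 // ltr_nat.
move=> hk; rewrite divr_gt0 ?sin_pos //.
by have := sin_pos 1%N; rewrite mul1r; apply; lia.
Qed.

Let sin_neq0 : sin (pi / p%:R) != 0 :> R.
Proof.
have : 0 < sine_ratio 1 by apply: sine_ratio_gt0; lia.
by rewrite /sine_ratio mul1r; case: eqP => // ->; rewrite mul0r ltxx.
Qed.

Lemma sine_ratio0 : sine_ratio 0 = 0.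
Proof. by rewrite /sine_ratio mul0r sin0 mul0r. Qed.

Lemma sine_ratio1 : sine_ratio 1 = 1.
Proof. by rewrite /sine_ratio mul1r divff. Qed.

Lemma sine_ratio_rec k :
  sine_ratio k.+2 + sine_ratio k = lambda R p * sine_ratio k.+1.
Proof.
rewrite /sine_ratio /lambda -mulrDl [RHS]mulrA; congr (_ / _).
set t := pi / p%:R.
have -> : k.+2%:R * t = k.+1%:R * t + t by rewrite -[k.+2]addn1 natrD mulrDl mul1r.
have -> : k%:R * t = k.+1%:R * t - t.
  by rewrite -[k.+1]addn1 natrD mulrDl mul1r addrK.
by rewrite sinD sinB; ring.
Qed.

Let p_neq0 : p%:R != 0 :> R.
Proof. by rewrite pnatr_eq0; lia. Qed.

Lemma sine_ratio_full : sine_ratio p = 0.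
Proof. by rewrite /sine_ratio mulrCA divff // mulr1 sinpi mul0r. Qed.

Lemma sine_ratio_last : sine_ratio p.-1 = 1.
Proof.
rewrite /sine_ratio.
have -> : p.-1%:R * (pi / p%:R) = pi - pi / p%:R :> R.
  have -> : p.-1%:R = p%:R - 1 :> R by rewrite -subn1 natrB //; lia.
  by field.
by rewrite sinB sinpi cospi mul0r sub0r mulN1r opprK divff.
Qed.

End SineRatio.

(** * Functions interpolated from the outer edge, and their Wronskian *)

Section Harmonic.
Variables (R : realType) (N : nat) (e : rel nat).
Hypothesis pg : polygon_graph N e.

Definition interpolating (f : nat -> R) : Prop :=
  forall P k, gon ltn e P -> (k < size P)%N ->
    f (nth 0%N P k) = f (head 0%N P) * sine_ratio R (size P) ((size P).-1 - k)
                    + f (last 0%N P) * sine_ratio R (size P) k.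

(** The values are prescribed from the outer edge inwards: a vertex v receives its value from the
    ends of the innermost edge over it. The coefficients are positive, so positivity is
    inherited. *)
Lemma interpolating_exists (a b : R) : exists f,
  [/\ f 0%N = a, f N.-1 = b, interpolating f
    & 0 <= a -> 0 <= b -> 0 < a + b -> forall v, (0 < v < N.-1)%N -> 0 < f v].
Proof.
have hN := N_gt2 pg.
have /choice[ap apP] : forall v, exists z : nat * nat, (0 < v < N.-1)%N ->
    [/\ e z.1 z.2, (z.1 < v < z.2)%N
      & forall u w, e u w -> (u < v < w)%N -> (u <= z.1)%N /\ (z.2 <= w)%N].
  move=> v; have [hv|hv] := boolP (0 < v < N.-1)%N; last by exists (0%N, 0%N).
  by have [x [y H]] := gon_apex pg hv; exists (x, y).
pose tl v := below e (ap v).1 (ap v).2.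
pose Phi (f : nat -> R) v := if v == 0%N then a else if v == N.-1 then b else
  if (v < N)%N then
  f (ap v).1 * sine_ratio R (size (tl v)) ((size (tl v)).-1 - index v (tl v))
  + f (ap v).2 * sine_ratio R (size (tl v)) (index v (tl v)) else 0.
(* The ends of the innermost edge over v lie on the outer edge or under a strictly longer innermost
   edge, so the rank drops and iterating [Phi] becomes stationary. *)
pose rank v := if (0 < v < N.-1)%N then (N - ((ap v).2 - (ap v).1))%N else 0%N.
have rank_lt v : (0 < v < N.-1)%N ->
    (rank (ap v).1 < rank v)%N /\ (rank (ap v).2 < rank v)%N.
  move=> hv; have [e1 h1 h2] := apP v hv; have h0 := e_lt pg e1.
  have rv : rank v = (N - ((ap v).2 - (ap v).1))%N by rewrite /rank hv.
  split.
    rewrite {1}/rank; case: ifP => hx; last by rewrite rv; nlia.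
    have [e2 h3 h4] := apP _ hx; have h5 := e_lt pg e2.
    have h6 : ((ap v).2 <= (ap (ap v).1).2)%N.
      by rewrite leqNgt; apply/negP => h; apply: (e_cross pg e2 e1); nlia.
    by rewrite rv; nlia.
  rewrite {1}/rank; case: ifP => hx; last by rewrite rv; nlia.
  have [e2 h3 h4] := apP _ hx; have h5 := e_lt pg e2.
  have h6 : ((ap (ap v).2).1 <= (ap v).1)%N.
    by rewrite leqNgt; apply/negP => h; apply: (e_cross pg e1 e2); nlia.
  by rewrite rv; nlia.
pose f0 := iter N.+1 Phi (fun _ => 0).
have stable m v : (rank v < m)%N -> iter m.+1 Phi (fun _ => 0) v = iter m Phi (fun _ => 0) v.
  elim: m v => // m IH v hv.
  rewrite iterS [in RHS]iterS /Phi; case: eqP => // v0; case: eqP => // vN.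
  case: ifP => // vN'.
  have hv' : (0 < v < N.-1)%N by nlia.
  have [r1 r2] := rank_lt v hv'.
  by rewrite !IH //; nlia.
have fix0 v : Phi f0 v = f0 v.
  rewrite /f0 -iterS; apply: stable; rewrite /rank; case: ifP => //; nlia.
have f00 : f0 0%N = a by rewrite -fix0.
have f0N : f0 N.-1 = b.
  by rewrite -fix0 /Phi eqxx; case: eqP => // h; nlia.
have f0v v : (0 < v < N.-1)%N -> f0 v =
    f0 (ap v).1 * sine_ratio R (size (tl v)) ((size (tl v)).-1 - index v (tl v))
    + f0 (ap v).2 * sine_ratio R (size (tl v)) (index v (tl v)).
  move=> hv; rewrite -{1}fix0 /Phi.
  have /negbTE-> : v != 0%N by nlia.
  have /negbTE-> : v != N.-1 by nlia.
  by have -> : (v < N)%N by nlia.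
have itp : interpolating f0.
  move=> P k gP hk; have [sz sP _] := gP.
  have [k0|k0] := eqVneq k 0%N.
    by rewrite k0 subn0 sine_ratio0 mulr0 addr0 nth0 sine_ratio_last ?mulr1 //.
  have [kl|kl] := eqVneq k (size P).-1.
    by rewrite kl subnn sine_ratio0 mulr0 add0r nth_last sine_ratio_last ?mulr1.
  (* A middle vertex of P has the base of P as the innermost edge over it, so its value was defined
     by P. *)
  have hv : (head 0%N P < nth 0%N P k < last 0%N P)%N.
    by rewrite -nth0 -nth_last !sorted_nth_ltn //; nlia.
  have bd := e_lt pg (gon_base gP).
  have hv' : (0 < nth 0%N P k < N.-1)%N by nlia.
  have [e1 h1 h2] := apP _ hv'.
  have [h3 h4] := gon_apexP pg gP (mem_nth _ hk) hv e1 h1.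
  have [h5 h6] := h2 _ _ (gon_base gP) hv.
  have E1 : (ap (nth 0%N P k)).1 = head 0%N P by nlia.
  have E2 : (ap (nth 0%N P k)).2 = last 0%N P by nlia.
  by rewrite f0v // /tl E1 E2 -(gon_below_base pg gP) index_uniq // (gon_uniq gP).
exists f0; split=> // a0 b0 ab.
have pos n : forall v, (rank v < n)%N -> (v < N)%N ->
    if (0 < v < N.-1)%N then 0 < f0 v else 0 <= f0 v.
  elim: n => // n IH v hr hvN; case: ifP => hv; last first.
    have [v0|v0] := eqVneq v 0%N; first by rewrite v0 f00.
    have -> : v = N.-1 by nlia.
    by rewrite f0N.
  have [e1 h1 h2] := apP v hv; have bd := e_lt pg e1.
  have gP : gon ltn e (tl v) by apply: (gon_below pg) => //; nlia.
  have xy : ((ap v).1 <= (ap v).2)%N by nlia.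
  have vP : v \in tl v.
    rewrite mem_below //; apply/andP; split; first by nlia.
    apply/(coveredP _ _ xy) => -[u [w [k1 k2 k3 k4]]].
    have [|l1 l2] := h2 u w k1; first by nlia.
    by apply: k2; congr (_, _); nlia.
  have iv : (0 < index v (tl v) < (size (tl v)).-1)%N.
    have hi : (index v (tl v) < size (tl v))%N by rewrite index_mem.
    have n0 : index v (tl v) <> 0%N.
      by move=> h; have := nth_index 0%N vP; rewrite h nth0 head_below //; nlia.
    have nl : index v (tl v) <> (size (tl v)).-1.
      by move=> h; have := nth_index 0%N vP; rewrite h nth_last last_below //; nlia.
    by nlia.
  have [r1 r2] := rank_lt v hv.
  have [sz _ _] := gP.
  rewrite f0v //.
  have s1 : 0 < sine_ratio R (size (tl v)) ((size (tl v)).-1 - index v (tl v)).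
    by apply: sine_ratio_gt0 => //; nlia.
  have s2 : 0 < sine_ratio R (size (tl v)) (index v (tl v)).
    by apply: sine_ratio_gt0 => //; nlia.
  have := IH (ap v).1; case: ifP => hx /(_ ltac:(nlia) ltac:(nlia)) px;
  have := IH (ap v).2; case: ifP => hy /(_ ltac:(nlia) ltac:(nlia)) py.
  - by apply: addr_gt0; exact: mulr_gt0.
  - by have := mulr_gt0 px s1; have := mulr_ge0 py (ltW s2); clear; lra.
  - by have := mulr_ge0 px (ltW s1); have := mulr_gt0 py s2; clear; lra.
  (* In the remaining case the base is the outer edge, with values a and b, at least one of which is
     positive. *)
  have E1 : (ap v).1 = 0%N by nlia.
  have E2 : (ap v).2 = N.-1 by nlia.
  rewrite E1 E2 f00 f0N.
  have [b1|b1] := eqVneq b 0.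
    by rewrite b1 mul0r addr0; apply: mulr_gt0 => //; move: ab; rewrite b1 addr0.
  have b2 : 0 < b by rewrite lt_neqAle eq_sym b1.
  by have := mulr_ge0 a0 (ltW s1); have := mulr_gt0 b2 s2; clear; lra.
by move=> v hv; have := pos (rank v).+1 v (ltnSn _) ltac:(nlia); rewrite hv.
Qed.

Definition gon_weight v : R := \sum_(P <- gons_at N e v) lambda R (size P).

(** With this sign the sum of the two neighbouring values in the recursion becomes a difference of
    successor and predecessor, which telescopes around v. It also records that going once around the
    polygon reverses the sign of a solution. *)
Definition signed (f : nat -> R) v w := if (v < w)%N then f w else - f w.

(** In the middle of P this is the recursion of the sine ratios. At the two ends of the base it
    comes from the value lambda at [(size P).-2], which follows from the values 1 and 0 at the next
    two indices. *)
Lemma interpolating_local f P v : interpolating f -> gon ltn e P -> v \in P ->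
  lambda R (size P) * f v = signed f v (gon_succ P v) - signed f v (gon_pred P v).
Proof.
move=> itp gP /(nthP 0%N)[k hk <-]; have [sz sP _] := gP.
rewrite (gon_succ_nth gP) // (gon_pred_nth gP) // /signed.
have I := itp P _ gP.
have -> : (if k.+1 == size P then head 0%N P else nth 0%N P k.+1)
   = nth 0%N P (if k.+1 == size P then 0%N else k.+1).
  by case: ifP; rewrite ?nth0.
have -> : (if k == 0%N then last 0%N P else nth 0%N P k.-1)
   = nth 0%N P (if k == 0%N then (size P).-1 else k.-1).
  by case: ifP; rewrite ?nth_last.
set i := if k.+1 == _ then _ else _; set j := if k == _ then _ else _.
have hi : (i < size P)%N by rewrite /i; case: eqP => h; nlia.
have hj : (j < size P)%N by rewrite /j; case: eqP => h; nlia.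
rewrite !sorted_nth_ltn // !I // /i /j {i j hi hj}.
set x := f _; set y := f _.
pose s := sine_ratio R (size P); rewrite -!/(s _).
have s0 : s 0%N = 0 by exact: sine_ratio0.
have s1 : s 1%N = 1 by exact: sine_ratio1.
have sl : s (size P).-1 = 1 by exact: sine_ratio_last.
have sf : s (size P) = 0 by exact: sine_ratio_full.
have rec m : s m.+2 = lambda R (size P) * s m.+1 - s m.
  by rewrite -sine_ratio_rec addrK.
have recl : s (size P).-2 = lambda R (size P).
  have := rec (size P).-2.
  have -> : (size P).-2.+2 = size P by nlia.
  have -> : (size P).-2.+1 = (size P).-1 by nlia.
  by rewrite sf sl mulr1 => /eqP; rewrite eq_sym subr_eq0 => /eqP.
have [k0|k0] := eqVneq k 0%N.
  rewrite k0; have /negbTE-> : 1%N != size P by nlia.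
  have -> : (0 < (size P).-1)%N by nlia.
  rewrite /= subn0 subn1 subnn s0 s1 sl recl; ring.
have [k1|k1] := eqVneq k.+1 (size P).
  have -> : k = (size P).-1 by nlia.
  rewrite /= subnn subn0 sl s0.
  have -> : ((size P).-1 < (size P).-2)%N = false by nlia.
  have -> : ((size P).-1 - (size P).-2)%N = 1%N by nlia.
  rewrite s1 recl; ring.
have -> : (k < k.+1)%N by nlia.
have -> : (k < k.-1)%N = false by nlia.
have := rec k.-1; have := rec ((size P).-1 - k.+1)%N.
have -> : ((size P).-1 - k.+1).+2 = ((size P).-1 - k.-1)%N by nlia.
have -> : ((size P).-1 - k.+1).+1 = ((size P).-1 - k)%N by nlia.
have -> : k.-1.+2 = k.+1 by nlia.
have -> : k.-1.+1 = k by nlia.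
move=> -> ->; ring.
Qed.

Lemma interpolating_rec f v : interpolating f -> (v < N)%N ->
  gon_weight v * f v
  = signed f v (cyc_succ N v) - signed f v (cyc_pred N v).
Proof.
move=> itp hv; rewrite -(telescope_around pg) // /gon_weight mulr_suml.
apply: eq_big_seq => P /(gons_atP pg)[gP vP]; exact: interpolating_local.
Qed.

(* W u v is the length of the diagonal from u to v. *)
Lemma polygon_lengths : exists W : nat -> nat -> R,
  [/\ forall u v, W u v = - W v u,
      forall u v, (u < v < N)%N -> 0 < W u v,
      forall v, (v.+1 < N)%N -> W v v.+1 = 1 &
     [/\ forall u v, (v.+2 < N)%N ->
        gon_weight v.+1 * W u v.+1 = W u v.+2 + W u v,
      forall u, gon_weight 0 * W u 0%N = W u 1%N - W u N.-1 &
      forall u, gon_weight N.-1 * W u N.-1 = W u N.-2 - W u 0%N ]].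
Proof.
have hN := N_gt2 pg.
have rec f : interpolating f -> [/\
    forall v, (v.+2 < N)%N -> gon_weight v.+1 * f v.+1 = f v.+2 + f v,
    gon_weight 0 * f 0%N = f 1%N - f N.-1 &
    gon_weight N.-1 * f N.-1 = f N.-2 - f 0%N].
  move=> itp; split=> [v hv||].
  - rewrite (interpolating_rec itp); last by nlia.
    rewrite /cyc_succ /cyc_pred /signed /=.
    have /negbTE-> : v.+1 != N.-1 by nlia.
    have -> : (v.+1 < v.+2)%N by nlia.
    have -> : (v.+1 < v)%N = false by nlia.
    by rewrite opprK.
  - rewrite (interpolating_rec itp); last by nlia.
    rewrite /cyc_succ /cyc_pred /signed /=.
    have /negbTE-> : 0%N != N.-1 by nlia.
    by have -> : (0 < N.-1)%N by nlia.
  - rewrite (interpolating_rec itp); last by nlia.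
    rewrite /cyc_succ /cyc_pred /signed /= eqxx.
    have /negbTE-> : N.-1 != 0%N by nlia.
    have -> : (N.-1 < 0)%N = false by nlia.
    have -> : (N.-1 < N.-2)%N = false by nlia.
    by rewrite opprK addrC.
have [f [f0 fN itf posf]] := interpolating_exists 1 0.
have [g [g0 gN itg posg]] := interpolating_exists 0 1.
have [rf rf0 rfN] := rec f itf; have [rg rg0 rgN] := rec g itg.
pose W u v := f u * g v - g u * f v.
(* The Wronskian of two solutions of the same recursion is constant; m counts the steps down from
   the last side, where it equals [f N.-2], which is [f 0]. *)
have W1 m v : (v + m = N.-2)%N -> W v v.+1 = 1.
  elim: m v => [|m IH] v hm.
    have -> : v.+1 = N.-1 by nlia.
    have -> : v = N.-2 by nlia.
    move: rfN; rewrite /W fN gN f0 mulr0 => /eqP; rewrite eq_sym subr_eq0 => /eqP ->.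
    by ring.
  rewrite -(IH v.+1); last by nlia.
  rewrite /W.
  have Hf := rf v ltac:(nlia); have Hg := rg v ltac:(nlia).
  have -> : f v = gon_weight v.+1 * f v.+1 - f v.+2 by rewrite Hf; ring.
  have -> : g v = gon_weight v.+1 * g v.+1 - g v.+2 by rewrite Hg; ring.
  by ring.
have W1' v : (v.+1 < N)%N -> W v v.+1 = 1.
  by move=> hv; apply: (W1 (N.-2 - v)%N); nlia.
have fpos v : (v < N.-1)%N -> 0 < f v.
  case: v => [|v] hv; first by rewrite f0.
  by apply: posf; rewrite ?ler01 // addr0.
exists W; split=> // [u v|u v huv|].
- by rewrite /W; ring.
- have [vN|vN] := eqVneq v N.-1.
    by rewrite /W vN fN gN mulr1 mulr0 subr0 fpos //; nlia.
  elim: v huv vN => [|v IH] huv vN; first by nlia.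
  have [->|uv] := eqVneq u v; first by rewrite W1' //; nlia.
  have h1 : 0 < W u v by apply: IH; nlia.
  have h2 : 0 < f v by apply: fpos; nlia.
  have h3 : 0 < f v.+1 by apply: fpos; nlia.
  have h4 : 0 < f u by apply: fpos; nlia.
  rewrite -(pmulr_lgt0 _ h2).
  (* This is the Ptolemy relation for u, v, v+1 and the last vertex, because [f u] is [W u N.-1]. *)
  have -> : W u v.+1 * f v = W u v * f v.+1 + f u * W v v.+1 by rewrite /W; ring.
  by rewrite W1' ?mulr1 ?addr_gt0 ?mulr_gt0 //; nlia.
split=> [u v hv|u|u].
- by rewrite /W mulrBr mulrCA rg // [_ * (g u * _)]mulrCA rf //; ring.
- by rewrite /W mulrBr mulrCA rg0 [_ * (g u * _)]mulrCA rf0; ring.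
by rewrite /W mulrBr mulrCA rgN [_ * (g u * _)]mulrCA rfN; ring.
Qed.

End Harmonic.

(** * Matching sums and friezes *)

Section MatchingSums.
Variables (R : realType) (T : tiling).

Definition tile_weight (k : int) : R := \sum_(P \in incident T k) lambda R (sides P).

(** If X equals Q, the last run grows by one and the Chebyshev recursion applies; otherwise X opens
    a run of its own, of weight lambda. *)
Lemma wtL_run_rcons2 (P Q X : T) k w :
  wtL_run R P k.+1 (rcons (rcons w Q) X) =
  lambda R (sides X) * wtL_run R P k.+1 (rcons w Q)
  - (if Q == X then wtL_run R P k.+1 w else 0).
Proof.
elim: w P k => [|Y w IH] P k.
  rewrite /=; case: (eqVneq Q P) => [->|QP].
    rewrite eq_sym; case: (eqVneq P X) => [->|PX]; first by rewrite /=; ring.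
    by rewrite /=; ring.
  rewrite [X == Q]eq_sym; case: (eqVneq Q X) => [->|QX]; by rewrite /=; ring.
rewrite !rcons_cons /=; case: eqP => YP; first exact: IH.
by rewrite IH; case: ifP => _; ring.
Qed.

Lemma wtL_rcons2 (Q X : T) w :
  wtL R (rcons (rcons w Q) X) =
  lambda R (sides X) * wtL R (rcons w Q) - (if Q == X then wtL R w else 0).
Proof.
case: w => [|P w] /=; last exact: wtL_run_rcons2.
by rewrite [X == Q]eq_sym; case: (eqVneq Q X) => [->|_] /=; ring.
Qed.

Hypothesis fin : forall k, finite_set (incident T k).
Hypothesis one : forall k, exists P, incident T k `&` incident T (k + 1) = [set P].

Lemma incident_seq : exists L : int -> seq T, forall k,
  uniq (L k) /\ incident T k = [set` L k].
Proof.
suff H : forall k, exists s : seq T, uniq s /\ incident T k = [set` s].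
  by have [L HL] := choice H; exists L.
move=> k; have /finite_seqP[s Es] := fin k.
exists (undup s); split; first exact: undup_uniq.
by rewrite Es; apply/seteqP; split=> x /=; rewrite mem_undup.
Qed.

(** Summing [wtL_rcons2] over the last two entries Q and X, the correction term occurs only for Q =
    X. By [one] this happens for exactly one pair, so the corrections add up to the matching sum two
    steps earlier. *)
Lemma matching_sum_rec :
  [/\ forall i, matching_sum R T i i = 0,
      forall i, matching_sum R T i (i + 1) = 1
    & forall i (d : nat), matching_sum R T i (i + d.+2%:Z) =
        tile_weight (i + d.+1%:Z) * matching_sum R T i (i + d.+1%:Z)
        - matching_sum R T i (i + d%:Z)].
Proof.
have [L HL] := incident_seq.
have Lu k : uniq (L k) by case: (HL k).
have LE k : incident T k = [set` L k] by case: (HL k).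
have qE k : tile_weight k = \sum_(P <- L k) lambda R (sides P).
  by rewrite /tile_weight LE -fsbig_seq.
(* [M i m] lists the matchings with m entries, which are those between i and i + 1 + m. *)
pose M (i : int) := fix M m : seq (seq T) :=
  if m is m'.+1 then [seq rcons w P | w <- M m', P <- L (i + 1 + m'%:Z)] else [:: [::]].
have Msize (i : int) m w : w \in M i m -> size w = m.
  elim: m w => [|m IH] w /=; first by rewrite inE => /eqP->.
  by move=> /allpairsP[[v P] /= [/IH vM _ ->]]; rewrite size_rcons vM.
have Mu (i : int) m : uniq (M i m).
  elim: m => //= m IH; apply: allpairs_uniq => // -[v P] [v' P'] _ _ /=.
  by move=> /rcons_inj[-> ->].
have ME (i : int) m : @matchings T i (i + 1 + m%:Z) = [set` M i m].
  elim: m => [|m IH].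
    apply/seteqP; split=> w /=; rewrite inE.
      move=> [sz _]; apply/eqP/size0nil => /=; lia.
    by move=> /eqP ->; split=> //=; lia.
  apply/seteqP; split=> w /=.
    case/lastP: w => [[/=]|w P]; first by lia.
    rewrite /matchings /= size_rcons => -[sz H].
    apply/allpairsP; exists (w, P) => /=.
    have szw : size w = m by lia.
    have wM : [set` M i m] w.
      rewrite -IH; split=> [|P0 k hk]; first by lia.
      by have := H P0 k (ltnW hk); rewrite nth_rcons hk.
    split=> //.
    have := H P m; rewrite szw ltnSn nth_rcons szw ltnn eqxx => /(_ isT).
    by rewrite LE.
  move=> /allpairsP[[v P] /= [vM PL ->]].
  have szv := Msize _ _ _ vM.
  have : [set` M i m] v by [].
  rewrite -IH => -[sz H]; split; first by rewrite size_rcons; lia.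
  move=> P0 k; rewrite size_rcons ltnS leq_eqVlt nth_rcons => /orP[/eqP ->|hk].
    by rewrite ltnn eqxx szv LE.
  by rewrite hk; apply: H.
have SE (i : int) m : matching_sum R T i (i + 1 + m%:Z) = \sum_(w <- M i m) wtL R w.
  by rewrite /matching_sum ME -fsbig_seq.
have S0 (i : int) : matching_sum R T i i = 0.
  rewrite /matching_sum (_ : @matchings T i i = set0) ?fsbig_set0 //.
  by apply/seteqP; split=> w //= -[sz _]; lia.
have S1 (i : int) : matching_sum R T i (i + 1) = 1.
  by have := SE i 0%N; rewrite addr0 => ->; rewrite big_seq1.
split=> // i [|d].
  have := SE i 1%N; rewrite -addrA => ->.
  rewrite S1 addr0 S0 subr0 mulr1 qE /= big_cat /= big_nil addr0 big_map.
  by rewrite addr0; apply: eq_bigr => P _ /=; ring.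
have -> : i + d.+3%:Z = i + 1 + d.+2%:Z by lia.
have -> : i + d.+2%:Z = i + 1 + d.+1%:Z by lia.
have -> : i + d.+1%:Z = i + 1 + d%:Z by lia.
rewrite !SE /= !big_allpairs_dep qE.
set A := L (i + 1 + d%:Z); set B := L (i + 1 + d.+1%:Z).
have uA : uniq A := Lu _; have uB : uniq B := Lu _.
rewrite big_distrr -sumrB; apply: eq_bigr => w _ /=.
have AB : \sum_(Q <- A) \sum_(X <- B) (if Q == X then wtL R w else 0) = wtL R w.
  have [P HP] := one (i + 1 + d%:Z).
  have PA : [set P] P by [].
  rewrite -HP (_ : i + 1 + d%:Z + 1 = i + 1 + d.+1%:Z) in PA; last by lia.
  rewrite !LE in PA; case: PA => PA PB.
  have inner Q : \sum_(X <- B) (if Q == X then wtL R w else 0)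
      = if Q \in B then wtL R w else 0.
    case: ifP => QB.
      rewrite (bigD1_seq Q) //= eqxx big1 ?addr0 // => X XQ.
      by rewrite eq_sym (negbTE XQ).
    by rewrite big_seq big1 // => X XB; case: eqP => // QX; rewrite QX XB in QB.
  rewrite (eq_bigr _ (fun Q _ => inner Q)) (bigD1_seq P) //= ifT //.
  rewrite big_seq_cond big1 ?addr0 // => Q /andP[QA QP]; case: ifP => // QB.
  have : [set P] Q.
    rewrite -HP (_ : i + 1 + d%:Z + 1 = i + 1 + d.+1%:Z); last by lia.
    by rewrite !LE.
  by move=> /= QP'; rewrite QP' eqxx in QP.
rewrite -[X in _ = _ - X]AB big_distrr -sumrB; apply: eq_bigr => Q _ /=.
rewrite big_distrl -sumrB; apply: eq_bigr => X _ /=.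
exact: wtL_rcons2.
Qed.

End MatchingSums.

(** * Friezes determined by their quiddity row *)

Section FriezeComparison.
Variables (R : realType) (q : int -> R) (f g : int -> nat -> R).
Hypothesis f0 : forall i, f i 0%N = 0.
Hypothesis f1 : forall i, f i 1%N = 1.
Hypothesis f2 : forall i, f (i - 1) 2%N = q i.
Hypothesis g0 : forall i, g i 0%N = 0.
Hypothesis g1 : forall i, g i 1%N = 1.
Hypothesis g_rec : forall i d,
  g i d.+2 = q (i + d.+1%:Z) * g i d.+1 - g i d.

(** The rows i - 1 and i solve a recursion with the same coefficient in each column, so their
    determinant does not depend on the column. *)
Lemma g_diamond i d :
  g (i - 1) d.+1 * g i d.+1 - g i d * g (i - 1) d.+2 = 1.
Proof.
elim: d => [|d IH]; first by rewrite g0 !g1; ring.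
rewrite -[RHS]IH [g i d.+2]g_rec [g (i - 1) d.+3]g_rec.
have -> : i - 1 + d.+2%:Z = i + d.+1%:Z by lia.
by ring.
Qed.

(** The unimodular rule gives [f i d.+3] after division by [g (i + 1) d.+1], by induction on the
    distance d. *)
Lemma frieze_unique_pos n :
  (forall i d, (d.+2 <= n)%N ->
    f (i - 1) d.+1 * f i d.+1 - f i d * f (i - 1) d.+2 = 1) ->
  (forall i d, (0 < d)%N -> (d.+2 <= n)%N -> g i d != 0) ->
  forall d i, (d <= n)%N -> f i d = g i d.
Proof.
move=> f_diamond g_neq0; elim/ltn_ind => -[|[|[|d]]] IH i dn.
- by rewrite f0 g0.
- by rewrite f1 g1.
- rewrite g_rec g1 g0 mulr1 subr0; have := f2 (i + 1); rewrite addrK => ->.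
  by [].
have := g_diamond (i + 1) d.+1; have := f_diamond (i + 1) d.+1 dn.
rewrite addrK !(IH d.+2) ?(IH d.+1) //; try lia.
move=> <- /eqP; rewrite (inj_eq (addrI _)) eqr_opp.
rewrite (inj_eq (mulfI _)); first by move/eqP.
by apply: g_neq0 => //; lia.
Qed.

Lemma frieze_unique_rec :
  (forall i d, f i d.+2 = q (i + d.+1%:Z) * f i d.+1 - f i d) ->
  forall d i, f i d = g i d.
Proof.
move=> f_rec d i; elim/ltn_ind: d => -[|[|d]] IH; rewrite ?f0 ?f1 ?g0 ?g1 //.
by rewrite f_rec g_rec !IH.
Qed.

(** By induction, the two lower rows of the vanishing 3 by 3 determinant satisfy the recursion along
    the columns. Column operations then leave the defect of the top row times a 2 by 2 minor, which
    is 1 by the unimodular rule. *)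
Lemma tame_rec :
  (forall i d, f (i - 1) d.+1 * f i d.+1 - f i d * f (i - 1) d.+2 = 1) ->
  (forall i d, \det (\matrix_(r < 3, c < 3) f (i + r%:Z) (d + 2 + c - r)%N) = 0) ->
  forall i d, f i d.+2 = q (i + d.+1%:Z) * f i d.+1 - f i d.
Proof.
move=> f_diamond tm i d.
elim/ltn_ind: d i => -[|[|d]] IH i.
- by have := f2 (i + 1); rewrite addrK f0 f1 subr0 mulr1 => ->.
- have := f_diamond (i + 1) 1%N; have := f2 (i + 1); have := f2 (i + 2).
  rewrite !addrK f1.
  have -> : i + 2 - 1 = i + 1 by lia.
  by move=> -> ->; have -> : i + 2%:Z = i + 2 by []; rewrite f1; lra.
have := tm i d.
rewrite (expand_det_row _ 0) !big_ord_recl big_ord0 /cofactor.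
rewrite !(expand_det_row _ 0) !big_ord_recl !big_ord0 /cofactor !det_mx11 !mxE /=.
rewrite /bump /= !(add0n, addn0, add1n, expr0, expr1, mul1r, addr0).
have -> : (d + 2 - 0 = d.+2)%N by lia.
have -> : (d + 2 + 1 - 0 = d.+3)%N by lia.
have -> : (d + 2 + 2 - 0 = d.+4)%N by lia.
have -> : (d + 2 - 1 = d.+1)%N by lia.
have -> : (d + 2 + 1 - 1 = d.+2)%N by lia.
have -> : (d + 2 + 2 - 1 = d.+3)%N by lia.
have -> : (d + 2 - 2 = d)%N by lia.
have -> : (d + 2 + 1 - 2 = d.+1)%N by lia.
have -> : (d + 2 + 2 - 2 = d.+2)%N by lia.
have := f_diamond (i + 2%:Z) d.
have -> : i + 2%:Z - 1 = i + 1%:Z by lia.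
rewrite [f (i + 1%:Z) d.+3]IH // [f (i + 2%:Z) d.+2]IH //.
have -> : i + 1%:Z + d.+2%:Z = i + d.+3%:Z by lia.
have -> : i + 2%:Z + d.+1%:Z = i + d.+3%:Z by lia.
move=> D H.
have : (f i d.+4 - q (i + d.+3%:Z) * f i d.+3 + f i d.+2) *
  (f (i + 1%:Z) d.+1 * f (i + 2%:Z) d.+1 - f (i + 2%:Z) d * f (i + 1%:Z) d.+2) = 0.
  by rewrite -[RHS]H; ring.
by rewrite D mulr1; lra.
Qed.

End FriezeComparison.

(** * Windows *)

Section Window.
Variables (V : choiceType) (lt side : rel V) (D : dissection lt side).

Lemma edge_noncrossing :
  (forall x y z t, side x y || side z t -> ~~ [&& lt x z, lt z y & lt y t]) ->
  noncrossing lt (edge D).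
Proof.
move=> H x y z t exy ezt.
have [h|] := boolP (side x y || side z t); first exact: H.
rewrite negb_or => /andP[/negbTE h1 /negbTE h2].
by apply: (arc_noncrossing (d := D)); [move: exy|move: ezt]; rewrite /edge ?h1 ?h2.
Qed.

Hypothesis ord : strict_total lt.
Hypothesis nc : noncrossing lt (edge D).
Variables (N : nat) (pt : nat -> V).

(* The points pt 0, ..., pt (N-1) are the vertices of a union of subgons. *)
Definition window : Prop :=
  [/\ (2 < N)%N, forall a b, (a < N)%N -> (b < N)%N -> lt (pt a) (pt b) = (a < b)%N,
      forall a, (a.+1 < N)%N -> edge D (pt a) (pt a.+1)
    & edge D (pt 0%N) (pt N.-1)].

Definition window_edge : rel nat :=
  fun a b => [&& (a < b)%N, (b < N)%N & edge D (pt a) (pt b)].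

Definition within v : Prop := forall P, subgon D P -> pt v \in P ->
  forall x, x \in P -> exists2 a, (a < N)%N & x = pt a.

Hypothesis win : window.

Lemma window_lt a b : (a < N)%N -> (b < N)%N -> lt (pt a) (pt b) = (a < b)%N.
Proof. by case: win => _ + _ _; apply. Qed.

Lemma window_graph : polygon_graph N window_edge.
Proof.
have [h1 h2 h3 h4] := win; split=> //.
- by move=> x y /and3P[-> ->].
- by move=> x hx; rewrite /window_edge ltnSn hx h3.
- by rewrite /window_edge h4 andbT; nlia.
move=> x y z t /and3P[xy yN exy] /and3P[zt tN ezt].
have := nc exy ezt; rewrite !window_lt //; nlia.
Qed.

Lemma pt_inj : {in [pred a | (a < N)%N] &, injective pt}.
Proof.
move=> a b; rewrite !inE => ha hb E; case: ord => irr _ _.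
have := window_lt ha hb; have := window_lt hb ha; rewrite E !irr; nlia.
Qed.

Lemma window_gon P : all (fun a => a < N)%N P ->
  gon ltn window_edge P <-> subgon D (map pt P).
Proof.
move=> /allP aN; have ptn x0 i : (i < size P)%N -> nth x0 (map pt P) i = pt (nth 0%N P i).
  by move=> hi; rewrite (nth_map 0%N).
have bd i : (i < size P)%N -> (nth 0%N P i < N)%N by move=> hi; apply/aN/mem_nth.
have srt : sorted lt (map pt P) = sorted ltn P.
  rewrite sorted_map; apply: (@eq_in_sorted _ (mem P)); last exact/allP.
  by move=> a b aP bP; rewrite /= window_lt // aN.
have ev x0 i j : sorted ltn P -> (i < j < size P)%N ->
    window_edge (nth 0%N P i) (nth 0%N P j)
    = edge D (nth x0 (map pt P) i) (nth x0 (map pt P) j).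
  move=> sP /andP[ij js]; have is' := ltn_trans ij js.
  by rewrite /window_edge sorted_nth_ltn // ij bd // !ptn.
split=> -[]; rewrite ?size_map ?srt => sz sP ed; split; rewrite ?size_map ?srt // => x0 i j hij.
  by rewrite -ev // (ed 0%N).
have hi : (i < size P)%N by nlia.
have hj : (j < size P)%N by nlia.
by rewrite !(set_nth_default 0%N x0) // (ev (pt 0%N)) // (ed (pt 0%N)).
Qed.

Lemma window_gon_lt P : gon ltn window_edge P -> all (fun a => a < N)%N P.
Proof.
move=> gP; apply/allP => a aP.
by have := gon_le gP aP; have := e_lt window_graph (gon_base gP); nlia.
Qed.

Lemma mem_map_pt P v : all (fun a => a < N)%N P -> (v < N)%N ->
  (pt v \in map pt P) = (v \in P).
Proof.
move=> /allP aN vN; apply/mapP/idP => [[a aP E]|vP]; last by exists v.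
by rewrite (pt_inj _ _ E) // inE ?aN.
Qed.

Lemma window_lift v P : within v -> subgon D P -> pt v \in P ->
  exists2 Q, all (fun a => a < N)%N Q & P = map pt Q.
Proof.
move=> wv sP vP; have := wv P sP vP; elim: P {sP vP} => [|x P IH] H.
  by exists [::].
have [Q aQ ->] : exists2 Q, all (fun a => a < N)%N Q & P = map pt Q.
  by apply: IH => y yP; apply: H; rewrite inE yP orbT.
have [a aN ->] := H x (mem_head _ _).
by exists (a :: Q) => //=; rewrite aN.
Qed.

Lemma window_incidentP v P : (v < N)%N -> within v ->
  (subgon D P /\ pt v \in P)
  <-> exists2 Q, gon ltn window_edge Q /\ v \in Q & P = map pt Q.
Proof.
move=> vN wv; split=> [[sP vP]|[Q [gQ vQ] ->]].
  have [Q aQ E] := window_lift wv sP vP; exists Q => //.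
  by rewrite E in sP vP; rewrite -(mem_map_pt aQ) // window_gon.
have aQ := window_gon_lt gQ.
by rewrite mem_map_pt // -window_gon.
Qed.

Lemma window_incident v : (v < N)%N -> within v ->
  [set P | subgon D P /\ pt v \in P]
  = [set` [seq map pt Q | Q <- gons_at N window_edge v]].
Proof.
move=> vN wv; apply/seteqP; split=> P /=.
  move/(window_incidentP _ vN wv) => [Q [gQ vQ] ->].
  by apply/mapP; exists Q => //; apply/(gons_atP window_graph).
case/mapP => Q /(gons_atP window_graph)[gQ vQ] E.
by apply/(window_incidentP _ vN wv); exists Q.
Qed.

Lemma map_pt_inj P Q : all (fun a => a < N)%N P -> all (fun a => a < N)%N Q ->
  map pt P = map pt Q -> P = Q.
Proof.
elim: P Q => [|a P IH] [|b Q] //= /andP[aN aP] /andP[bN bQ] [E1 E2].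
by rewrite (pt_inj _ _ E1) ?inE // (IH Q).
Qed.

Lemma window_weight (R : realType) v : (v < N)%N -> within v ->
  \sum_(P \in [set P | subgon D P /\ pt v \in P]) lambda R (size P)
  = gon_weight R N window_edge v.
Proof.
move=> vN wv; rewrite window_incident // -fsbig_seq.
  by rewrite big_map; apply: eq_bigr => Q _; rewrite size_map.
rewrite map_inj_in_uniq ?gons_at_uniq // => P Q.
move=> /(gons_atP window_graph)[gP _] /(gons_atP window_graph)[gQ _].
by apply: map_pt_inj; apply: window_gon_lt.
Qed.

Lemma window_common u v : (u < N)%N -> (v < N)%N -> within u ->
  (exists P, forall Q, (gon ltn window_edge Q /\ u \in Q /\ v \in Q) <-> Q = P) ->
  exists P, forall Q, (subgon D Q /\ pt u \in Q /\ pt v \in Q) <-> Q = P.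
Proof.
move=> uN vN wu [P HP]; have [gP [uP vP]] : gon ltn window_edge P /\ u \in P /\ v \in P.
  exact/HP.
have aP := window_gon_lt gP.
exists (map pt P) => Q; split=> [[sQ [uQ vQ]]|->]; last first.
  by rewrite !mem_map_pt // -window_gon.
have [Q' aQ' E] := window_lift wu sQ uQ.
rewrite E in sQ uQ vQ *; congr (map pt _); apply/HP.
by rewrite -(mem_map_pt aQ') // -(mem_map_pt aQ') // window_gon.
Qed.

End Window.

Lemma finite_set_seq (T : choiceType) (s : seq T) : finite_set [set` s].
Proof. by apply/finite_seqP; exists s. Qed.

Section FriezeMatching.
Variables (R : realType) (T : tiling) (F : int -> int -> R).
Hypothesis fin : forall k, finite_set (incident T k).
Hypothesis one : forall k, exists P, incident T k `&` incident T (k + 1) = [set P].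
Hypothesis F0 : forall i, F i i = 0.
Hypothesis F1 : forall i, F i (i + 1) = 1.
Hypothesis rF : realizable T F.

Let f i (d : nat) := F i (i + d%:Z).
Let g i (d : nat) := matching_sum R T i (i + d%:Z).

Let f0 i : f i 0%N = 0. Proof. by rewrite /f addr0. Qed.
Let f1 i : f i 1%N = 1. Proof. exact: F1. Qed.
Let f2 i : f (i - 1) 2%N = tile_weight R T i.
Proof. by rewrite -[RHS]rF /f /quiddity; congr (F _ _); lia. Qed.
Let g0 i : g i 0%N = 0.
Proof. by have [+ _ _] := matching_sum_rec R fin one; rewrite /g addr0; apply. Qed.
Let g1 i : g i 1%N = 1.
Proof. by have [_ + _] := matching_sum_rec R fin one; apply. Qed.
Let g_rec i d : g i d.+2 = tile_weight R T (i + d.+1%:Z) * g i d.+1 - g i d.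
Proof. by have [_ _ +] := matching_sum_rec R fin one; apply. Qed.

Lemma frieze_matching_pos (n : nat) :
  (forall i j, i <= j -> (j + 1) - (i - 1) <= n%:Z ->
     F (i - 1) j * F i (j + 1) - F i j * F (i - 1) (j + 1) = 1) ->
  (forall i (d : nat), (0 < d)%N -> (d.+2 <= n)%N ->
     0 < matching_sum R T i (i + d%:Z)) ->
  forall i j, 0 <= j - i <= n%:Z -> F i j = matching_sum R T i j.
Proof.
move=> Fd pos i j hij.
have -> : j = i + `|j - i|%N%:Z by lia.
apply: (frieze_unique_pos f0 f1 f2 g0 g1 g_rec (n := n)); last by lia.
  move=> {hij} {}i d hd; rewrite -[RHS](Fd i (i + d%:Z)); try lia.
  by rewrite /f; congr (F _ _ * F _ _ - _ * F _ _); lia.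
by move=> {hij} {}i d d0 hd; rewrite lt0r_neq0 // pos.
Qed.

Lemma frieze_matching_tame :
  (forall i j, i <= j ->
     F (i - 1) j * F i (j + 1) - F i j * F (i - 1) (j + 1) = 1) ->
  tame F -> forall i j, i <= j -> F i j = matching_sum R T i j.
Proof.
move=> Fd tF i j hij.
have -> : j = i + `|j - i|%N%:Z by lia.
apply: (frieze_unique_rec f0 f1 g0 g1 g_rec).
apply: (tame_rec f0 f1 f2) => {hij} {}i d.
  rewrite -[RHS](Fd i (i + d%:Z)); try lia.
  by rewrite /f; congr (F _ _ * F _ _ - _ * F _ _); lia.
rewrite -[RHS](tF i (i + (d + 2)%N%:Z)); last by lia.
congr (\det _); apply/matrixP => r c; rewrite !mxE /f.
by congr (F _ _); have := ltn_ord r; lia.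
Qed.

End FriezeMatching.

(** * Matching sums in a strip that is covered by windows *)

Section Strip.
Variables (U : choiceType) (lt side : rel (int + U)) (D : dissection lt side).

Definition strip_tiling : tiling :=
  @Tiling (seq (int + U)) (fun k => [set P | subgon D P /\ inl k \in P]) size.

(** Any stretch of lower points lies so deep in some window that all its incident subgons are
    visible there; c is the position where the stretch begins. *)
Definition has_windows : Prop := forall (a : int) (d : nat), exists N pt c,
  window D N pt /\ forall t, (t <= d)%N ->
    [/\ (c + t < N)%N, pt (c + t)%N = inl (a + t%:Z) & within D N pt (c + t)%N].

Hypothesis ord : strict_total lt.
Hypothesis nc : noncrossing lt (edge D).
Hypothesis windows : has_windows.

Lemma strip_finite k : finite_set (incident strip_tiling k).
Proof.
have [N [pt [c [win H]]]] := windows k 0; have [h1 h2 h3] := H 0%N isT.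
have := window_incident ord nc win h1 h3; rewrite h2 addr0 /= => ->.
exact: finite_set_seq.
Qed.

Lemma strip_common k : exists P, forall Q,
  (subgon D Q /\ inl k \in Q /\ inl (k + 1) \in Q) <-> Q = P.
Proof.
have [N [pt [c [win H]]]] := windows k 1; have [h1 h2 h3] := H 0%N isT.
have [h4 h5 _] := H 1%N isT.
have h6 : (c.+1 < N)%N by rewrite -addn1.
have [P HP] := window_common ord nc win h1 h4 h3
  ltac:(rewrite addn0 addn1; exact: gon_side (window_graph nc win) _ h6).
by exists P => Q; rewrite -HP h2 h5 addr0.
Qed.

Lemma strip_one k : exists P,
  incident strip_tiling k `&` incident strip_tiling (k + 1) = [set P].
Proof.
have [P HP] := strip_common k; exists P.
apply/seteqP; split=> Q /=; first by case=> -[h1 h2] [_ h3]; apply/HP.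
by move/HP => [h1 [h2 h3]].
Qed.

Lemma strip_positive (R : realType) i (d : nat) : (0 < d)%N ->
  0 < matching_sum R strip_tiling i (i + d%:Z).
Proof.
move=> d0; have [N [pt [c [win H]]]] := windows i d.
have [W [W_anti W_pos W1 [W_rec _ _]]] := polygon_lengths R (window_graph nc win).
have [S0 S1 S_rec] := matching_sum_rec R strip_finite strip_one.
have W0 v : W v v = 0 by have := W_anti v v; lra.
(* Both sides solve the same recursion, since the weights at these points can be computed in the
   window. *)
suff E t : (t <= d)%N -> matching_sum R strip_tiling i (i + t%:Z) = W c (c + t)%N.
  rewrite E // W_pos //; have [h _ _] := H d (leqnn d); nlia.
elim/ltn_ind: t => -[|[|t]] IH ht.
- by rewrite addr0 addn0 S0 W0.
- by have [h _ _] := H 1%N ht; rewrite S1 addn1 W1 // -addn1.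
rewrite S_rec !IH //; try nlia.
have [h1 h2 h3] := H t.+1 (ltnW ht); have [h4 _ _] := H _ ht.
have := window_weight ord nc win R h1 h3; rewrite h2 /tile_weight /= => ->.
by rewrite !addnS in h4 *; rewrite W_rec // addrK.
Qed.

Lemma strip_frieze (R : realType) (F : int -> int -> R) : frieze F ->
  realizable strip_tiling F ->
  forall i j, i <= j -> F i j = matching_sum R strip_tiling i j.
Proof.
move=> [F0 F1 Fd] rF i j ij.
(* An infinite frieze has no last row, so the bound may be the distance at hand. *)
apply: (frieze_matching_pos strip_finite strip_one F0 F1 rF (n := `|j - i|%N)); last by lia.
  by move=> i' j' ij' _; apply: Fd.
by move=> i' d d0 _; apply: strip_positive.
Qed.

End Strip.

(** * Matching sums in a dissected polygon *)

Section PolygonTiling.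
Variables (n : nat) (D : polygon_dissection n).
Hypothesis n_gt2 : (2 < n)%N.

Let n_gt0 : (0 < n)%N. Proof. by lia. Qed.
Let pt (a : nat) : 'I_n := insubd (Ordinal n_gt0) a.

Let pt_val a : (a < n)%N -> pt a = a :> nat.
Proof. by move=> h; rewrite /pt val_insubd h. Qed.

Lemma polygon_order : strict_total (@polygon_lt n).
Proof.
split=> [x|y x z|x y]; rewrite /polygon_lt; [lia|lia|].
by rewrite -(inj_eq val_inj) /=; lia.
Qed.

Lemma polygon_noncrossing : noncrossing (@polygon_lt n) (edge D).
Proof.
apply: edge_noncrossing => x y z t; rewrite /polygon_lt /polygon_side.
have := ltn_ord x; have := ltn_ord y; have := ltn_ord z; have := ltn_ord t; lia.
Qed.

Let win : window D n pt.
Proof.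
split=> // [a b ha hb|a ha|]; first by rewrite /polygon_lt !pt_val.
  by rewrite /edge /polygon_side !pt_val ?eqxx //; lia.
by rewrite /edge /polygon_side !pt_val ?eqxx ?orbT //; lia.
Qed.

Let wit v : within D n pt v.
Proof.
move=> P _ _ x _; exists (x : nat); first exact: ltn_ord.
by apply: val_inj => /=; rewrite pt_val.
Qed.

Let wg := window_graph polygon_noncrossing win.

Let residue (k : int) := `|(k %% n%:Z)%Z|%N.

Let residue_lt k : (residue k < n)%N.
Proof. by rewrite /residue; lia. Qed.

Let residueE k : k = (k %/ n%:Z)%Z * n%:Z + (residue k)%:Z.
Proof. by rewrite /residue gez0_abs ?modz_ge0 -?divz_eq //; lia. Qed.

Let residueP k (r : nat) t : (r < n)%N -> k = t * n%:Z + r%:Z -> residue k = r.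
Proof. by move=> rn ->; rewrite /residue modzMDl modz_small //; lia. Qed.

Let incidentE k :
  incident (polygon_tiling D) k = [set P | subgon D P /\ pt (residue k) \in P].
Proof.
apply/seteqP; split=> P /= [sP].
  move=> [x xP xk]; split=> //; suff -> : pt (residue k) = x by [].
  apply: val_inj; rewrite /= pt_val // /residue -xk modz_small //=.
  by have := ltn_ord x; lia.
move=> vP; split=> //; exists (pt (residue k)) => //.
rewrite pt_val // /residue gez0_abs ?modz_mod //.
by apply: modz_ge0; lia.
Qed.

Lemma polygon_finite k : finite_set (incident (polygon_tiling D) k).
Proof.
rewrite incidentE (window_incident polygon_order polygon_noncrossing win) //.
exact: finite_set_seq.
Qed.

Let residueS k : residue (k + 1) =
  if (residue k).+1 == n then 0%N else (residue k).+1.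
Proof.
have := residueE k; have := residue_lt k; case: eqP => h hlt kE.
  by apply: (@residueP _ _ ((k %/ n%:Z)%Z + 1)) => //; rewrite mulrDl mul1r; lia.
by apply: (@residueP _ _ (k %/ n%:Z)%Z); lia.
Qed.

Lemma polygon_one k : exists P,
  incident (polygon_tiling D) k `&` incident (polygon_tiling D) (k + 1) = [set P].
Proof.
suff [P HP] : exists P, forall Q, (subgon D Q /\ pt (residue k) \in Q /\
    pt (residue (k + 1)) \in Q) <-> Q = P.
  exists P; rewrite !incidentE; apply/seteqP; split=> Q /=.
    by case=> -[h1 h2] [_ h3]; apply/HP.
  by move/HP => [h1 [h2 h3]].
apply: (window_common polygon_order polygon_noncrossing win) => //.
rewrite residueS; case: eqP => h; last first.
  by apply: gon_side wg _ _; have := residue_lt k; lia.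
have -> : residue k = n.-1 by lia.
(* The side from the last vertex back to the first is the outer edge of the window, with its only
   subgon below it. *)
have [P HP] := gon_bottom wg; exists P => Q; rewrite -HP.
by split=> -[h1 [h2 h3]].
Qed.

Lemma polygon_positive (R : realType) i (d : nat) : (0 < d)%N -> (d < n)%N ->
  0 < matching_sum R (polygon_tiling D) i (i + d%:Z).
Proof.
move=> d0 dn.
have [W [W_anti W_pos W1 [W_rec W_rec0 W_recn]]] := polygon_lengths R wg.
have [S0 S1 S_rec] := matching_sum_rec R polygon_finite polygon_one.
have W0 v : W v v = 0 by have := W_anti v v; lra.
have tw k : tile_weight R (polygon_tiling D) k = gon_weight R n (window_edge D n pt) (residue k).
  rewrite -(window_weight polygon_order polygon_noncrossing win) // -incidentE.
  by [].
move: W_rec W_rec0 W_recn tw.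
move: (gon_weight R n (window_edge D n pt)) => q W_rec W_rec0 W_recn tw.
set c := residue i; have cn : (c < n)%N := residue_lt i.
have res t : (t < n)%N ->
    residue (i + t%:Z) = if (c + t < n)%N then (c + t)%N else (c + t - n)%N.
  move=> ht; have := residueE i; rewrite -/c => iE; case: ifP => h.
    by apply: (@residueP _ _ (i %/ n%:Z)%Z) => //; lia.
  by apply: (@residueP _ _ ((i %/ n%:Z)%Z + 1)); [lia|rewrite mulrDl mul1r; lia].
(* After passing vertex 0 the arguments of W are exchanged: W is antisymmetric, and the recursion
   changes sign between the last vertex and vertex 0. *)
suff E t : (t < n)%N -> matching_sum R (polygon_tiling D) i (i + t%:Z) =
    if (c + t < n)%N then W c (c + t)%N else W (c + t - n)%N c.
  by rewrite E //; case: ifP => h; apply: W_pos; lia.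
elim/ltn_ind: t => -[|[|t]] IH ht.
- by rewrite addr0 addn0 S0 cn W0.
- rewrite S1 addn1; case: ifP => h; first by rewrite W1.
  (* The length 1 of the side between the last vertex and vertex 0 follows from the recursion at the
     last vertex, started there as well. *)
  have -> : c = n.-1 by lia.
  have -> : (n.-1.+1 - n = 0)%N by lia.
  have := W_recn n.-1; rewrite W0 mulr0 (W_anti _ 0%N) (W_anti _ n.-2).
  have -> : n.-1 = n.-2.+1 by lia.
  by rewrite W1; [lra|lia].
rewrite S_rec tw res; last by lia.
rewrite !IH //; try lia.
rewrite !addnS.
(* The three vertices of the recursion may lie before the passage, after it, or around it with
   vertex 0 or the last vertex in the middle. *)
case: (ltngtP (c + t).+2 n) => h1.
- have -> : (c + t < n)%N by lia.
  by rewrite W_rec // addrK.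
- have [h2|h2] := eqVneq (c + t).+1 n.
    have -> : (c + t < n)%N by lia.
    rewrite -h2 subnn (_ : ((c + t).+2 - (c + t).+1)%N = 1%N); last by lia.
    have := W_rec0 c; rewrite -h2 /= (W_anti c 0%N) (W_anti c 1%N).
    by lra.
  have -> : (c + t < n)%N = false by lia.
  have := W_rec c (c + t - n)%N.
  have -> : (c + t - n).+2 = ((c + t).+2 - n)%N by lia.
  have -> : (c + t - n).+1 = ((c + t).+1 - n)%N by lia.
  rewrite !(W_anti c) => /(_ _) H; have {H} := H ltac:(lia).
  by lra.
have -> : (c + t < n)%N by lia.
rewrite -h1 subnn; have := W_recn c; rewrite -h1 /= (W_anti c 0%N).
by lra.
Qed.

End PolygonTiling.

(** * Universal covers *)

(* Deck transformations move a bridging arc arbitrarily far to either side. *)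
Lemma deck_far (n : nat) (i a b : int) : (0 < n)%N -> exists s t : int,
  [/\ i + s * n%:Z < a, b < i + t * n%:Z & s < t].
Proof.
move=> n0; exists (- (`|i - a|%N.+1)%:Z), (`|i - b|%N.+1)%:Z.
by split; nia.
Qed.

Lemma punct_order : strict_total punct_lt.
Proof.
split=> [[x|[]]|[y|[]] [x|[]] [z|[]]|[x|[]] [y|[]]] //=; try lia.
by rewrite (inj_eq inl_inj) neq_lt.
Qed.

Section Punctured.
Variables (n : nat) (D : punctured_dissection n).

Lemma punct_noncrossing : noncrossing punct_lt (edge D).
Proof. by apply: edge_noncrossing => -[x|[]] [y|[]] [z|[]] [t|[]] //=; lia. Qed.

Hypothesis n_gt0 : (0 < n)%N.

Lemma punct_windows : has_windows D.
Proof.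
move=> a d; have [i0 arc0] := punct_bridging D.
have [s [t [hs ht st]]] := deck_far i0 a (a + d%:Z) n_gt0.
set A := i0 + s * n%:Z in hs; set B := i0 + t * n%:Z in ht.
have edge_deck r : edge D (inl (i0 + r * n%:Z)) (inr tt).
  by have := punct_periodic D r (inl i0) (inr tt); rewrite /edge /= => ->.
have eA : edge D (inl A) (inr tt) := edge_deck s.
have eB : edge D (inl B) (inr tt) := edge_deck t.
clearbody A B; pose m := `|B - A|%N.
(* The window is the polygon between two lifts of a bridging arc. A subgon incident to a point
   strictly between them cannot leave it, because neither lift separates its vertices. *)
pose pt p : int + unit := if (p <= m)%N then inl (A + p%:Z) else inr tt.
exists m.+2, pt, `|a - A|%N; split.
  split; first by rewrite /m; lia.
  - move=> p r hp hr; rewrite /pt; case: ifP => h1; case: ifP => h2 /=; lia.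
  - move=> p hp; rewrite /pt.
    have -> : (p <= m)%N by lia.
    case: ifP => h /=; first by rewrite /edge /=; apply/orP; left; lia.
    by have -> : A + p%:Z = B by lia.
  - by rewrite /pt /= ltnn addr0.
move=> p hp; have E : pt (`|a - A| + p)%N = inl (a + p%:Z).
  by rewrite /pt ifT; [congr inl; lia|lia].
split=> //; first by rewrite /m; lia.
rewrite /within E => P sP aP [u|[]] xP; last by exists m.+1 => //; rewrite /pt ltnn.
have uA : A <= u.
  rewrite leNgt; apply/negP => h.
  apply: (gon_separated punct_order punct_noncrossing sP eA aP xP) => //=; lia.
have uB : u <= B.
  rewrite leNgt; apply/negP => h.
  apply: (gon_separated punct_order punct_noncrossing sP eB xP aP) => //=; lia.
by exists `|u - A|%N; rewrite /pt ?ifT; [rewrite /m; lia|congr inl; lia|rewrite /m; lia].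
Qed.

End Punctured.

Lemma ann_order : strict_total ann_lt.
Proof.
split=> [[x|x]|[y|y] [x|x] [z|z]|[x|x] [y|y]] //=; try lia.
  by rewrite (inj_eq inl_inj) neq_lt.
by rewrite (inj_eq inr_inj) neq_lt orbC.
Qed.

Section Annulus.
Variables (n m : nat) (D : annulus_dissection n m).

Lemma ann_noncrossing : noncrossing ann_lt (edge D).
Proof. by apply: edge_noncrossing => -[x|x] [y|y] [z|z] [t|t] //=; lia. Qed.

Hypothesis n_gt0 : (0 < n)%N.

Lemma ann_windows : has_windows D.
Proof.
move=> a d; have [i0 [k0 arc0]] := ann_bridging D.
have [s [t [hs ht st]]] := deck_far i0 a (a + d%:Z) n_gt0.
set A := i0 + s * n%:Z in hs; set B := i0 + t * n%:Z in ht.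
pose k := k0 + s * m%:Z; pose l := k0 + t * m%:Z.
have kl : k <= l by rewrite /k /l; nia.
have edge_deck r : edge D (inl (i0 + r * n%:Z)) (inr (k0 + r * m%:Z)).
  by have := ann_periodic D r (inl i0) (inr k0); rewrite /edge /= => ->.
have eA : edge D (inl A) (inr k) := edge_deck s.
have eB : edge D (inl B) (inr l) := edge_deck t.
clearbody A B k l; pose b := `|B - A|%N; pose c := `|l - k|%N.
(* The lower points run from A to B and the upper ones back from l to k, following the boundary
   order [ann_lt]. *)
pose pt p : int + int :=
  if (p <= b)%N then inl (A + p%:Z) else inr (l - (p - b.+1)%N%:Z).
exists (b + c).+2, pt, `|a - A|%N; split.
  split; first by rewrite /b; lia.
  - move=> p r hp hr; rewrite /pt; case: ifP => h1; case: ifP => h2 /=; lia.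
  - move=> p hp; rewrite /pt; case: ifP => h1; case: ifP => h2; try lia.
    + by rewrite /edge /=; apply/orP; left; lia.
    + have -> : A + p%:Z = B by lia.
      by have -> : l - (p.+1 - b.+1)%N%:Z = l by lia.
    + by rewrite /edge /=; apply/orP; left; lia.
  - rewrite /pt /= addr0 ifF; last by lia.
    by have -> : l - ((b + c).+1 - b.+1)%N%:Z = k by lia.
move=> p hp; have E : pt (`|a - A| + p)%N = inl (a + p%:Z).
  by rewrite /pt ifT; [congr inl; lia|lia].
split=> //; first by rewrite /b; lia.
rewrite /within E => P sP aP x xP.
have inA : ~ (ann_lt x (inl A) || ann_lt (inr k) x).
  by move=> h; apply: (gon_separated ann_order ann_noncrossing sP eA aP xP) => //=; lia.
have inB : ~ (ann_lt (inl B) x && ann_lt x (inr l)).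
  move=> /andP[h1 h2].
  by apply: (gon_separated ann_order ann_noncrossing sP eB xP aP) => //=; lia.
case: x xP inA inB => u xP /= inA inB.
  exists `|u - A|%N; first by rewrite /b; lia.
  by rewrite /pt ifT; [congr inl; lia|rewrite /b; lia].
exists (b.+1 + `|l - u|)%N; first by rewrite /c; lia.
by rewrite /pt ifF; [congr inr; lia|lia].
Qed.

(** * Quotient dissections *)

Section QuotientTiling.
Variable E : seq (int + int) -> seq (int + int) -> Prop.
Hypothesis qE : quotient_dissection D E.

Lemma same_orbit_inner X Y : same_orbit n m X Y ->
  has_inner_vertex X <-> has_inner_vertex Y.
Proof.
move=> [t ->]; split=> [[k kX]|[k /mapP[[u|u] uX] //= _]]; last by exists u.
by exists (k + t * m%:Z); apply/mapP; exists (inr k).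
Qed.

Lemma quotient_inner X Y : E X Y ->
  same_orbit n m X Y \/ has_inner_vertex X /\ has_inner_vertex Y.
Proof.
elim: qE X Y => [X Y h|E' P Q _ IH [_ _ _ [iP iQ] _] X Y]; first by left.
have inn A B : E' A B -> has_inner_vertex A <-> has_inner_vertex B.
  by case/IH => [/same_orbit_inner|[]].
by case=> [/IH //|[/inn h1 /inn h2]|[/inn h1 /inn h2]]; right; tauto.
Qed.

Local Notation related := (clos_refl_sym_trans _ (strip_identified D E)).

(** A single identification joins subgons of different orbits, hence, by [quotient_inner], subgons
    with inner vertices. *)
Lemma related_inner X Y : related X Y ->
  X = Y \/ has_inner_vertex X /\ has_inner_vertex Y.
Proof.
elim=> {X Y} [X Y [_ EXY nXY _]|X|X Y _ [->|[]]|X Y Z _ [->|[hX hY]] _ [<-|[hY' hZ]]];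
  try by [left|right].
by have [|] := quotient_inner EXY; [|right].
Qed.

Lemma strip_classE P Q : related P Q -> strip_class D E P = strip_class D E Q.
Proof.
move=> PQ; apply/seteqP; split=> X /= h; apply: rst_trans h => //.
exact: rst_sym.
Qed.

(* A chain of identified subgons leading from the left of the edge (k, k + 1) to
   its right passes through the subgon at that edge. *)
Lemma related_across k P Q T0 :
  (forall X, (subgon D X /\ inl k \in X /\ inl (k + 1) \in X) <-> X = T0) ->
  subgon D P -> subgon D Q -> inl k \in P -> inl (k + 1) \in Q -> related P Q ->
  related P T0.
Proof.
move=> T0P sP sQ kP kQ PQ; have [PE|[iP iQ]] := related_inner PQ.
  have <- : P = T0 by apply/T0P; do 2 split=> //; rewrite PE.
  exact: rst_refl.
(* An edge of X that passed over z would separate z from the inner vertex of Y. *)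
have no_arc z X u w : (exists2 Y, subgon D Y /\ has_inner_vertex Y & inl z \in Y) ->
    subgon D X -> inl u \in X -> inl w \in X -> u < z -> z < w -> inl z \in X.
  move=> [Y [sY [y yY]] zY] sX uX wX uz zw; apply/negPn/negP => zX.
  have [sz srt ed] := sX.
  have [||||j [hj h1 h2]] := @sorted_gap _ _ ann_order (inl z) X (inl z)
    (index (inl u) X) (index (inl w) X) srt zX; rewrite ?index_mem ?nth_index //.
  have jw : (index (inl w) X < size X)%N by rewrite index_mem.
  have eJ : edge D (nth (inl z) X j) (nth (inl z) X j.+1).
    by rewrite ed ?eqxx //; nlia.
  apply: (gon_separated ann_order ann_noncrossing sY eJ zY yY h1 h2).
  have : nth (inl z) X j.+1 = inl w \/ ann_lt (nth (inl z) X j.+1) (inl w).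
    have [jE|jE] := eqVneq j.+1 (index (inl w) X).
      by left; rewrite jE nth_index.
    by right; rewrite -[X in ann_lt _ X](nth_index (inl z) wX) (sorted_nth_lt ann_order) //; nlia.
  by case=> [->|]; [|case: (nth _ _ _)] => //=; rewrite ?orbT.
(* A subgon with outer vertices on both sides of the boundary edge must contain both of its ends, as
   P and Q reach the upper line from there. *)
have sided X u w : subgon D X -> inl u \in X -> inl w \in X -> u <= k -> k < w -> X = T0.
  move=> sX uX wX uk kw; apply/T0P; split=> //; split.
    have [<-//|uk'] := eqVneq u k.
    by apply: (@no_arc k X u w) => //; [exists P|lia].
  have [<-//|kw'] := eqVneq w (k + 1).
  by apply: (@no_arc (k + 1) X u w) => //; [exists Q|lia|lia].
apply: contrapT => nPT.
pose low (X : seq (int + int)) := forall u : int, inl u \in X -> u <= k.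
(* Identified subgons share an outer vertex, so a chain avoiding [T0] never changes sides. *)
have step X Y : related X Y -> related P X -> low X <-> low Y.
  elim=> {X Y} [X Y XY PX|//|X Y XY IH PY|X Y Z XY IH1 YZ IH2 PX].
  - have [[sX sY] _ _ [z [zX zY]]] := XY; have PY : related P Y.
      by apply: rst_trans PX _; apply: rst_step.
    have aux (A B : seq (int + int)) : subgon D B -> related P B -> inl z \in A -> inl z \in B ->
        low A -> low B.
      move=> sB PB zA zB lA u uB; rewrite leNgt; apply/negP => ku.
      by apply: nPT; rewrite -(sided B z u) // lA.
    by split; [apply: (aux X)|apply: (aux Y)].
  - by rewrite IH //; apply: rst_trans PY _; apply: rst_sym.
  by rewrite IH1 // IH2 //; apply: rst_trans PX _.
have : low Q.
  apply/(step P Q PQ (rst_refl _ _ _)) => u uP; rewrite leNgt; apply/negP => ku.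
  by apply: nPT; rewrite -(sided P k u) //; exact: rst_refl.
by move=> /(_ _ kQ); lia.
Qed.

Lemma quotient_finite k : finite_set (incident (quotient_cover D E) k).
Proof.
exact: finite_image (strip_finite ann_order ann_noncrossing ann_windows k).
Qed.

Lemma quotient_one k : exists P, incident (quotient_cover D E) k
  `&` incident (quotient_cover D E) (k + 1) = [set P].
Proof.
have [T0 HT] := strip_common ann_order ann_noncrossing ann_windows k.
have [sT [kT kT']] : subgon D T0 /\ inl k \in T0 /\ inl (k + 1) \in T0 by apply/HT.
exists (strip_class D E T0); apply/seteqP; split=> C /=; last first.
  by move=> ->; split; exists T0.
move=> [[P [sP kP] <-] [Q [sQ kQ] QP]]; apply: strip_classE.
apply: (@related_across k P Q) => //.
have : strip_class D E Q Q by exact: rst_refl.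
by rewrite QP.
Qed.

End QuotientTiling.
End Annulus.

Theorem theorem6p7 (R : realType) (ps : seq nat) (n : nat) (F : int -> int -> R) :
  (forall D : polygon_dissection n,
     (3 <= n)%N ->
     finite_frieze (n - 3) F -> type_Lambda ps F ->
     realizable (polygon_tiling D) F ->
     forall i j : int, 0 <= j - i <= n%:Z ->
       F i j = matching_sum R (polygon_tiling D) i j)
  /\
  ((0 < n)%N -> frieze F -> n_periodic n F -> type_Lambda ps F ->
     (forall D : punctured_dissection n,
        realizable (punctured_cover D) F ->
        forall i j : int, i <= j ->
          F i j = matching_sum R (punctured_cover D) i j)
     /\
     (forall (m : nat) (D : annulus_dissection n m),
        (0 < m)%N ->
        realizable (annulus_cover D) F ->
        forall i j : int, i <= j ->
          F i j = matching_sum R (annulus_cover D) i j)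
     /\
     (forall (m : nat) (D : annulus_dissection n m)
             (E : seq (int + int) -> seq (int + int) -> Prop),
        (0 < m)%N ->
        quotient_dissection D E ->
        tame F ->
        realizable (quotient_cover D E) F ->
        forall i j : int, i <= j ->
          F i j = matching_sum R (quotient_cover D E) i j)).
Proof.
split=> [D n3 [F0 F1 Fd _] _ rF|n0 fF _ _].
  apply: (frieze_matching_pos (polygon_finite D n3) (polygon_one D n3) F0 F1 rF).
    by move=> i j ij h; apply: Fd => //; lia.
  by move=> i d d0 dn; apply: polygon_positive => //; lia.
split=> [D rF|].
  exact: (strip_frieze punct_order (@punct_noncrossing n D) (@punct_windows n D n0) fF rF).
split=> [m D _ rF|m D E _ qE tF rF].
  exact: (strip_frieze ann_order (@ann_noncrossing n m D) (@ann_windows n m D n0) fF rF).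
(* The windows give positivity for the strip before identification only; for the quotient, tameness
   supplies the recursion to be compared. *)
have [F0 F1 Fd] := fF.
exact: (frieze_matching_tame (@quotient_finite n m D n0 E) (@quotient_one n m D n0 E qE)
  F0 F1 rF Fd tF).
Qed.
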